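(* Let $\Bbbk$ be a field, $S=\Bbbk[x_1,\dots,x_n]$, and let $a=x_p$, $b=x_q$ be two variables with $p<q$. Let $I\subset S$ be a monomial ideal, let $t\ge0$ be an integer, and let $J=\operatorname{Shift}_{a,b,t}(I)$ be the $t$-th $(a,b)$-shift of $I$. Then $b_{i,j}(J)\ge b_{i,j}(I)$ for all $i,j$.
   Context: $b_{i,j}(M)=\dim_{\Bbbk}\operatorname{Tor}^S_i(\Bbbk,M)_j$ are the graded Betti numbers over the standard graded ring $S$. For a monomial ideal $I$ and integer $t\ge0$, $\operatorname{Shift}_{a,b,t}(I)$ is the $\Bbbk$-vector space (which is an ideal of $S$) spanned by the following monomials, where $f$ ranges over all monomials not divisible by $a$ or $b$, and $r,s,\ell$ over nonnegative integers with $r<t$ and $s<\ell$: - $fa^sb^r$ such that $fa^sb^r\in I$ (for all $s\ge0$, $r<t$); - $fa^sb^{s+t}$ such that $fa^sb^{s+t}\in I$; - $fa^\ell b^{s+t}$ such that $fa^\ell b^{s+t}\in I$ or $fa^sb^{\ell+t}\in I$; - $fa^sb^{\ell+t}$ such that $fa^\ell b^{s+t}\in I$ and $fa^sb^{\ell+t}\in I$. *)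

(* Defs.v *)
From HB Require Import structures.
From mathcomp Require Import all_boot all_order all_algebra.
From mathcomp Require Import mpoly.
From Stdlib Require Import ClassicalEpsilon.

Set Implicit Arguments.
Unset Strict Implicit.
Unset Printing Implicit Defensive.

Import GRing.Theory.
Local Open Scope ring_scope.

Section MonomialIdeals.
Variables (k : fieldType) (n : nat).
Implicit Types (I : {mpoly k[n]} -> Prop) (A : 'X_{1..n} -> Prop).

Definition ideal_generated (G : {mpoly k[n]} -> Prop) (f : {mpoly k[n]}) :=
  exists s : seq ({mpoly k[n]} * {mpoly k[n]}),
    (forall u, u \in s -> G u.2) /\ f = \sum_(u <- s) u.1 * u.2.

Definition monomial_ideal I :=
  exists A, forall f,
    I f <-> ideal_generated (fun g => exists2 m, A m & g = 'X_[m]) f.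

Definition monomial_span A (f : {mpoly k[n]}) :=
  exists s : seq (k * 'X_{1..n}),
    (forall u, u \in s -> A u.2) /\ f = \sum_(u <- s) u.1 *: 'X_[u.2].

(* The exponent vector of f a^s b^r, where a = x_p and b = x_q. *)
Definition mon_ab (p q : 'I_n) (f : 'X_{1..n}) (s r : nat) : 'X_{1..n} :=
  (f + U_(p) *+ s + U_(q) *+ r)%MM.

Definition not_divisible (x : 'I_n) (f : 'X_{1..n}) : bool :=
  ~~ (U_(x) <= f)%MM.

Inductive shift_monomial (p q : 'I_n) (t : nat) I : 'X_{1..n} -> Prop :=
| ShiftLow f s r of not_divisible p f & not_divisible q f & (r < t)%N
    & I 'X_[mon_ab p q f s r] :
    shift_monomial p q t I (mon_ab p q f s r)
| ShiftDiag f s of not_divisible p f & not_divisible q f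
    & I 'X_[mon_ab p q f s (s + t)] :
    shift_monomial p q t I (mon_ab p q f s (s + t))
| ShiftUpper f s l of not_divisible p f & not_divisible q f & (s < l)%N
    & I 'X_[mon_ab p q f l (s + t)] \/ I 'X_[mon_ab p q f s (l + t)] :
    shift_monomial p q t I (mon_ab p q f l (s + t))
| ShiftLower f s l of not_divisible p f & not_divisible q f & (s < l)%N
    & I 'X_[mon_ab p q f l (s + t)] & I 'X_[mon_ab p q f s (l + t)] :
    shift_monomial p q t I (mon_ab p q f s (l + t)).

Definition Shift (p q : 'I_n) (t : nat) I : {mpoly k[n]} -> Prop :=
  monomial_span (shift_monomial p q t I).

End MonomialIdeals.

Section GradedBetti.
Variables (k : fieldType) (n : nat).
Notation S := {mpoly k[n]}.

(* The degree d component of the standard graded ring, for d : int. *)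
Definition in_degree (d : int) (f : S) : Prop :=
  if d is Posz e then f \is e.-homog else f = 0.

(* A sequence of graded free modules P_i = \bigoplus_l S(- res_deg i l) of
   finite rank, with maps P_(i+1) -> P_i, x |-> x *m res_diff i, and an
   augmentation P_0 -> k = S / (x_1, ..., x_n); see [augmentation]. *)
Record free_complex := FreeComplex {
  res_rank : nat -> nat;
  res_deg  : forall i, 'I_(res_rank i) -> int;
  res_diff : forall i, 'M[S]_(res_rank i.+1, res_rank i);
  res_aug  : 'I_(res_rank 0) -> k
}.

(* The S-linear map sending the l-th basis vector to res_aug l; S acts on k
   through the constant coefficient. *)
Definition augmentation (P : free_complex) (x : 'rV[S]_(res_rank P 0)) : k :=
  \sum_l (x 0 l)@_0%MM * res_aug l.

(* ... -> P_2 -> P_1 -> P_0 -> k -> 0 is exact and its maps have degree 0, the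
   residue field k being placed in degree 0. *)
Record resolves_residue_field (P : free_complex) : Prop := ResolvesResidueField {
  res_diff_homog : forall i u v,
    in_degree (res_deg (i := i.+1) u - res_deg (i := i) v) (res_diff P i u v);
  res_aug_homog : forall l, res_aug l != 0 -> res_deg (f := P) (i := 0) l = 0;
  res_aug_surj : forall c : k, exists x, augmentation (P := P) x = c;
  res_exact0 : forall x,
    augmentation (P := P) x = 0 <-> exists y, x = y *m res_diff P 0;
  res_exactS : forall i (x : 'rV[S]_(res_rank P i.+1)),
    x *m res_diff P i = 0 <-> exists y, x = y *m res_diff P i.+1
}.

(* The degree j component of P_i \otimes_S M for an ideal M of S, P_i \otimes_S M
   being the submodule M^(res_rank i) of S^(res_rank i). *)
Definition tensor_degree (P : free_complex) (M : S -> Prop) (i : nat) (j : int)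
    (x : 'rV[S]_(res_rank P i)) : Prop :=
  forall l, M (x 0 l) /\ in_degree (j - res_deg l) (x 0 l).

Definition tor_cycle (P : free_complex) (M : S -> Prop) (i : nat) (j : int) :
    'rV[S]_(res_rank P i) -> Prop :=
  match i with
  | 0 => fun x => tensor_degree M j x
  | i'.+1 => fun x => tensor_degree M j x /\ x *m res_diff P i' = 0
  end.

Definition tor_boundary (P : free_complex) (M : S -> Prop) (i : nat) (j : int)
    (x : 'rV[S]_(res_rank P i)) : Prop :=
  exists2 y, tensor_degree M j y & x = y *m res_diff P i.

(* Z / B has dimension b over k: it has a basis of b elements. *)
Definition quotient_dim (r : nat) (Z B : 'rV[S]_r -> Prop) (b : nat) : Prop :=
  exists v : 'I_b -> 'rV[S]_r,
    [/\ forall l, Z (v l),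
        forall z, Z z -> exists c : 'I_b -> k, B (z - \sum_l (c l)%:MP *: v l)
      & forall c : 'I_b -> k,
          B (\sum_l (c l)%:MP *: v l) -> forall l, c l = 0].

(* Tor^S(-, M) is the left derived functor of - \otimes_S M, so Tor^S_i(k, M) is
   the i-th homology of P \otimes_S M, P any resolution of k. *)
Definition tor_dim (M : S -> Prop) (i : nat) (j : int) (b : nat) : Prop :=
  exists2 P : free_complex, resolves_residue_field P
    & quotient_dim (tor_cycle (P := P) M (i := i) j)
                   (tor_boundary (P := P) M (i := i) j) b.

(* The b with dim_k Tor^S_i(k, M)_j = b; it exists and is unique because k has
   a graded free resolution of finite rank (the Koszul complex) and any two are
   homotopy equivalent. *)
Definition betti (M : S -> Prop) (i : nat) (j : int) : nat :=
  epsilon (inhabits 0%N) (tor_dim M i j).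

End GradedBetti.

(* Main.v *)
(* Betti numbers may be computed from the Koszul complex: two graded free
   resolutions of the residue field are homotopy equivalent, and the Koszul
   complex is contractible in every multidegree other than 0 by coning off a
   vertex of the support. For a monomial ideal I the degree j strand of the Koszul
   complex tensored with I is a coordinate subspace W_I of a finite-dimensional
   space V with basis the pairs (total multidegree, face).

   Exchanging x_p^a x_q^(b + t) and x_p^b x_q^(a + t) acts on V, up to signs, as a
   chain map. Let pi : V -> V be the chain map that moves every basis element lying
   in the lower half to its mirror image in the upper half (and kills those that
   are their own mirror image). For J = Shift I one has pi W_I = pi W_J, 1 - pi maps
   W_J into W_I, and W_I \cap ker pi is contained in W_J. Splitting dimensions along
   pi gives dim W_I <= dim W_J and rank (d | W_J) <= rank (d | W_I), hence the
   homology of W_J is at least as large as that of W_I. *)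

Require Import Defs.
From HB Require Import structures.
From mathcomp Require Import all_boot all_order all_algebra.
From mathcomp Require Import perm mpoly zify ring.
From Stdlib Require Import ClassicalEpsilon.

Set Implicit Arguments.
Unset Strict Implicit.
Unset Printing Implicit Defensive.

Import GRing.Theory.
Local Open Scope ring_scope.

(** Serves to build chain maps one position at a time. A next term exists only when the current one
    satisfies [G], so the recursion carries [G] in a sigma type. *)
Lemma dependent_choice (T : nat -> Type) (G : forall i, T i -> Prop)
    (R : forall i, T i -> T i.+1 -> Prop) (x0 : T 0) :
  G 0 x0 ->
  (forall i x, G i x -> exists2 y, R i x y & G i.+1 y) ->
  exists f : forall i, T i, f 0 = x0 /\ forall i, R i (f i) (f i.+1).
Proof.
move=> G0 step.
have next i (x : {x : T i | G i x}) :
    {y : {y : T i.+1 | G i.+1 y} | R i (sval x) (sval y)}.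
  case: x => x Gx /=; apply: constructive_indefinite_description.
  by have [y Rxy Gy] := step i x Gx; exists (exist _ y Gy).
pose g := nat_rect (fun i => {x : T i | G i x}) (exist _ x0 G0)
            (fun i x => sval (next i x)).
exists (fun i => sval (g i)); split=> // i.
exact: svalP (next i (g i)).
Qed.

(** * Graded components of polynomials *)

Section Degrees.
Variables (k : fieldType) (n : nat).
Notation S := {mpoly k[n]}.
Implicit Types (f g : S) (d e : int).

Lemma in_degreeP d f :
  in_degree d f <-> forall m, f@_m != 0 -> (mdeg m)%:Z = d.
Proof.
case: d => d /=.
  split=> [/dhomogP hf m|hf].
    by rewrite -mcoeff_msupp => /hf ->.
  by apply/dhomogP => m; rewrite mcoeff_msupp => /hf [].
split=> [-> m|hf]; first by rewrite mcoeff0 eqxx.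
apply/mpolyP => m; rewrite mcoeff0; apply/eqP/negPn/negP => /hf.
by [].
Qed.

(** Total on [int], with value 0 in negative degrees, so that differences of degree shifts need no
    sign condition. *)
Definition hcomp d f : S :=
  if d is Posz e then pihomog mdeg e f else 0.

Lemma hcomp_coeff d f m : (hcomp d f)@_m = if (mdeg m)%:Z == d then f@_m else 0.
Proof.
case: d => d /=; last by rewrite mcoeff0.
rewrite pihomogE raddf_sum /= eqz_nat.
have [<-|hm] := eqVneq.
  rewrite [f in RHS]mpolyE raddf_sum /= [LHS]big_mkcond /=.
  apply: eq_bigr => m' _; rewrite mcoeffZ mcoeffX.
  by have [->|] := eqVneq m' m; rewrite ?eqxx // mulr0 if_same.
apply: big1 => m' /eqP hm'; rewrite mcoeffZ mcoeffX.
by case: eqP => [e|]; [move: hm; rewrite -e hm' eqxx | rewrite mulr0].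
Qed.

Lemma in_degree_hcomp d f : in_degree d (hcomp d f).
Proof.
apply/in_degreeP => m; rewrite hcomp_coeff.
by have [//|_] := eqVneq (mdeg m)%:Z d; rewrite eqxx.
Qed.

Lemma hcomp_id d f : in_degree d f -> hcomp d f = f.
Proof.
move/in_degreeP=> hf; apply/mpolyP => m; rewrite hcomp_coeff.
by case: (eqVneq f@_m 0) => [->|/hf ->]; rewrite ?if_same ?eqxx.
Qed.

Lemma hcomp_sum (J : Type) (s : seq J) (P : pred J) (F : J -> S) d :
  hcomp d (\sum_(i <- s | P i) F i) = \sum_(i <- s | P i) hcomp d (F i).
Proof.
apply/mpolyP => m; rewrite hcomp_coeff !(raddf_sum (mcoeff m)) /=.
rewrite [RHS](eq_bigr _ (fun i _ => hcomp_coeff _ _ _)).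
by case: ifP => hm //; rewrite big1.
Qed.

Lemma hcompB d f g : hcomp d (f - g) = hcomp d f - hcomp d g.
Proof.
apply/mpolyP => m; rewrite mcoeffB !hcomp_coeff mcoeffB.
by have [//|_] := eqVneq (mdeg m)%:Z d; rewrite subr0.
Qed.

Lemma hcompMl d e f g : in_degree e f -> hcomp d (f * g) = f * hcomp (d - e) g.
Proof.
move/in_degreeP => hf; apply/mpolyP => m; rewrite hcomp_coeff !mcoeffM.
case: eqP => hm; last first.
  apply/esym/big1 => -[m1 m2] /= /eqP em; rewrite hcomp_coeff.
  have [->|/hf h1] := eqVneq f@_m1 0; first by rewrite mul0r.
  case: eqP => h2; last by rewrite mulr0.
  by case: hm; move: (congr1 mdeg em) h1 h2; rewrite mdegD; lia.
apply: eq_bigr => -[m1 m2] /= /eqP em; rewrite hcomp_coeff.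
have [->|/hf h1] := eqVneq f@_m1 0; first by rewrite !mul0r.
suff -> : (mdeg m2)%:Z == d - e by [].
by apply/eqP; move: (congr1 mdeg em) hm h1; rewrite mdegD; lia.
Qed.

Lemma hcompMr d e f g : in_degree e g -> hcomp d (f * g) = hcomp (d - e) f * g.
Proof. by move=> hg; rewrite mulrC (hcompMl _ _ hg) mulrC. Qed.

Lemma in_degreeM d e f g :
  in_degree d f -> in_degree e g -> in_degree (d + e) (f * g).
Proof.
move=> hf hg; suff <- : hcomp (d + e) (f * g) = f * g.
  exact: in_degree_hcomp.
rewrite (hcompMl _ _ hf) (_ : d + e - d = e) ?hcomp_id //; lia.
Qed.

Lemma in_degree0 d : in_degree d (0 : S).
Proof. by apply/in_degreeP => m; rewrite mcoeff0 eqxx. Qed.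

Lemma in_degreeB d f g : in_degree d f -> in_degree d g -> in_degree d (f - g).
Proof.
move=> hf hg; rewrite -(hcomp_id hf) -(hcomp_id hg) -hcompB.
exact: in_degree_hcomp.
Qed.

Lemma in_degree_sum (J : Type) (s : seq J) (P : pred J) (F : J -> S) d :
  (forall i, P i -> in_degree d (F i)) -> in_degree d (\sum_(i <- s | P i) F i).
Proof.
move=> hF; rewrite (eq_bigr (fun i => hcomp d (F i))).
  by rewrite -hcomp_sum; exact: in_degree_hcomp.
by move=> i /hF /hcomp_id.
Qed.

Lemma in_degreeC c f d : in_degree d f -> in_degree d (c%:MP * f).
Proof.
move/in_degreeP => hf; apply/in_degreeP => m.
by rewrite mcoeffCM mulf_eq0 negb_or => /andP[_ /hf].
Qed.

Definition is_submodule (M : S -> Prop) :=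
  [/\ M 0, forall f g, M f -> M g -> M (f + g) & forall f g, M g -> M (f * g)].

End Degrees.

Section Submodule.
Variables (k : fieldType) (n : nat) (M : {mpoly k[n]} -> Prop).
Hypothesis hM : is_submodule M.

Lemma submodule_sum (J : Type) (s : seq J) (P : pred J) (F : J -> {mpoly k[n]}) :
  (forall i, P i -> M (F i)) -> M (\sum_(i <- s | P i) F i).
Proof. by case: hM => M0 MD _ hF; elim/big_ind: _. Qed.

End Submodule.

(** * Dimensions of subquotients *)

Section QuotientDim.
Variables (k : fieldType) (n r : nat).
Notation S := {mpoly k[n]}.
Notation row := 'rV[S]_r.

(** Closure under constant polynomials only: a fixed-degree strand is a vector space over [k], not
    an [S]-module. *)
Definition is_subspace (B : row -> Prop) :=
  [/\ B 0, forall x y, B x -> B y -> B (x + y) & forall c x, B x -> B (c%:MP *: x)].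

Lemma subspace_comb (B : row -> Prop) b (c : 'I_b -> k) (x : 'I_b -> row) :
  is_subspace B -> (forall l, B (x l)) -> B (\sum_l (c l)%:MP *: x l).
Proof. by case=> B0 BD BZ hx; elim/big_ind: _ => // l _; apply: BZ. Qed.

Lemma subspaceB (B : row -> Prop) x y :
  is_subspace B -> B x -> B y -> B (x - y).
Proof.
by case=> B0 BD BZ hx hy; apply: BD => //; rewrite -scaleN1r -mpolyCN; apply: BZ.
Qed.

Lemma quotient_dim_le (Z B : row -> Prop) b b' :
  is_subspace B -> quotient_dim Z B b -> quotient_dim Z B b' -> (b <= b')%N.
Proof.
move=> hB [v [Zv _ freev]] [v' [_ genv' _]].
have /choice [c hc] : forall l, exists c : 'I_b' -> k,
    B (v l - \sum_l' (c l')%:MP *: v' l') by move=> l; apply: genv'.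
pose C := \matrix_(l < b, l' < b') c l l'.
rewrite leqNgt; apply/negP => ltb.
(* Modulo [B] the family [v] is [C] times [v']. With more rows than columns, [C] has a nonzero left
   kernel vector, which is a relation among the [v l] modulo [B]. *)
have /rowV0Pn [u /sub_kermxP uC] : kermx C != 0.
  rewrite kermx_eq0 /row_free neq_ltn.
  by rewrite (leq_ltn_trans (rank_leq_col C) ltb).
case/eqP; apply/rowP => l; rewrite mxE; move: l.
apply: freev.
have -> : \sum_l (u 0 l)%:MP *: v l =
    \sum_l (u 0 l)%:MP *: (v l - \sum_l' (c l l')%:MP *: v' l').
  under [RHS]eq_bigr do rewrite scalerBr.
  rewrite sumrB [X in _ - X](_ : _ = 0) ?subr0 //.
  under eq_bigr do rewrite scaler_sumr.
  rewrite exchange_big /= big1 // => l' _.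
  under eq_bigr do rewrite scalerA -mpolyCM.
  rewrite -scaler_suml -(raddf_sum (@mpolyC n k)) /=.
  suff -> : \sum_(l < b) u 0 l * c l l' = (u *m C) 0 l'.
    by rewrite uC mxE mpolyC0 scale0r.
  by rewrite mxE; apply: eq_bigr => l _; rewrite mxE.
exact: subspace_comb.
Qed.

End QuotientDim.

(** * Comparison of graded free resolutions *)

Section Comparison.
Variables (k : fieldType) (n : nat).
Notation S := {mpoly k[n]}.
Notation free_complex := (free_complex k n).
Implicit Types (P Q : free_complex).

(** Kernel of the map leaving position [i] of the augmented complex; this makes exactness uniform in
    [i]. *)
Definition syzygy P i : 'rV[S]_(res_rank P i) -> Prop :=
  match i with
  | 0 => fun x => augmentation (P := P) x = 0
  | i'.+1 => fun x => x *m res_diff P i' = 0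
  end.

Lemma syzygyP P i (x : 'rV_(res_rank P i)) : resolves_residue_field P ->
  syzygy x <-> exists y, x = y *m res_diff P i.
Proof. by case: i x => [|i] x [_ _ _ exact0 exactS]; [apply: exact0 | apply: exactS]. Qed.

(** Lifting property of free modules: a preimage is chosen for each basis vector. *)
Lemma factor_syzygies P i r (A : 'M_(r, res_rank P i)) :
  resolves_residue_field P -> (forall u, syzygy (row u A)) ->
  exists B, A = B *m res_diff P i.
Proof.
move=> hP hA.
have /choice [y hy] : forall u, exists y, row u A = y *m res_diff P i.
  by move=> u; apply/syzygyP.
exists (\matrix_u y u); apply/row_matrixP => u.
by rewrite row_mul rowK hy.
Qed.

Lemma augmentation_mul P r (x : 'rV[S]_r) (A : 'M_(r, res_rank P 0)) :
  augmentation (P := P) (x *m A) =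
  \sum_u (x 0 u)@_0%MM * augmentation (P := P) (row u A).
Proof.
rewrite /augmentation.
under eq_bigr do rewrite mxE (raddf_sum (mcoeff 0)) mulr_suml /=.
rewrite exchange_big; apply: eq_bigr => u _ /=.
rewrite mulr_sumr; apply: eq_bigr => v _.
by rewrite rmorphM mxE mulrA.
Qed.

Lemma augmentation_eq P r (A B : 'M_(r, res_rank P 0)) :
  (forall u, augmentation (P := P) (row u A) = augmentation (P := P) (row u B)) ->
  forall x, augmentation (P := P) (x *m A) = augmentation (P := P) (x *m B).
Proof.
by move=> eqAB x; rewrite !augmentation_mul; apply: eq_bigr => u _; rewrite eqAB.
Qed.

Definition homog_mx P Q i i' (phi : 'M[S]_(res_rank P i, res_rank Q i')) :=
  forall u v, in_degree (res_deg u - res_deg v) (phi u v).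

(** Lifts obtained by choice need not be homogeneous. Their degree 0 part is, and taking it commutes
    with multiplication by a homogeneous differential. *)
Definition hcomp_mx P Q i i' (phi : 'M[S]_(res_rank P i, res_rank Q i')) :=
  \matrix_(u, v) hcomp (res_deg u - res_deg v) (phi u v).

Lemma homog_hcomp_mx P Q i i' (phi : 'M[S]_(res_rank P i, res_rank Q i')) :
  homog_mx (hcomp_mx phi).
Proof. by move=> u v; rewrite mxE; apply: in_degree_hcomp. Qed.

Lemma hcomp_mx_id P Q i i' (phi : 'M[S]_(res_rank P i, res_rank Q i')) :
  homog_mx phi -> hcomp_mx phi = phi.
Proof. by move=> h; apply/matrixP => u v; rewrite mxE hcomp_id. Qed.

Lemma hcomp_mxMl P Q T i i' i'' (phi : 'M[S]_(res_rank P i, res_rank Q i'))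
    (psi : 'M[S]_(res_rank Q i', res_rank T i'')) :
  homog_mx phi -> hcomp_mx (phi *m psi) = phi *m hcomp_mx psi.
Proof.
move=> h; apply/matrixP => u v; rewrite !mxE hcomp_sum.
apply: eq_bigr => w _; rewrite (hcompMl _ _ (h u w)) mxE; congr (_ * hcomp _ _).
lia.
Qed.

Lemma hcomp_mxMr P Q T i i' i'' (phi : 'M[S]_(res_rank P i, res_rank Q i'))
    (psi : 'M[S]_(res_rank Q i', res_rank T i'')) :
  homog_mx psi -> hcomp_mx (phi *m psi) = hcomp_mx phi *m psi.
Proof.
move=> h; apply/matrixP => u v; rewrite !mxE hcomp_sum.
apply: eq_bigr => w _; rewrite (hcompMr _ _ (h w v)) mxE; congr (hcomp _ _ * _).
lia.
Qed.

Lemma homog_mxM P Q T i i' i'' (phi : 'M[S]_(res_rank P i, res_rank Q i'))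
    (psi : 'M[S]_(res_rank Q i', res_rank T i'')) :
  homog_mx phi -> homog_mx psi -> homog_mx (phi *m psi).
Proof.
by move=> h h'; rewrite -(hcomp_mx_id h') -hcomp_mxMl //; apply: homog_hcomp_mx.
Qed.

Lemma homog_mxB P Q i i' (phi psi : 'M[S]_(res_rank P i, res_rank Q i')) :
  homog_mx phi -> homog_mx psi -> homog_mx (phi - psi).
Proof. by move=> h h' u v; rewrite !mxE; apply: in_degreeB. Qed.

Lemma homog_mx1 P i : homog_mx (1%:M : 'M[S]_(res_rank P i, res_rank P i)).
Proof.
move=> u v; rewrite mxE; have [->|_] := eqVneq u v; last exact: in_degree0.
rewrite subrr; apply/in_degreeP => m; rewrite mcoeff1.
by have [->|_] := eqVneq m 0%MM; rewrite ?mdeg0 // eqxx.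
Qed.

Lemma homog_res_diff P i : resolves_residue_field P -> homog_mx (res_diff P i).
Proof. by case=> h _ _ _ _ u v; apply: h. Qed.

End Comparison.

Section ComparisonTheorem.
Variables (k : fieldType) (n : nat).
Notation S := {mpoly k[n]}.
Notation free_complex := (free_complex k n).
Implicit Types (P Q : free_complex).

Record chain_map P Q (phi : forall i, 'M[S]_(res_rank P i, res_rank Q i)) : Prop :=
  ChainMap {
    chain_map_homog : forall i, homog_mx (phi i);
    chain_map_comm : forall i, res_diff P i *m phi i = phi i.+1 *m res_diff Q i;
    chain_map_aug : forall x,
      augmentation (P := Q) (x *m phi 0) = augmentation (P := P) x
  }.

Lemma chain_map_exists P Q :
  resolves_residue_field P -> resolves_residue_field Q ->
  exists phi, chain_map (P := P) (Q := Q) phi.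
Proof.
move=> hP hQ.
have [phi0 aug0] : exists phi0 : 'M_(res_rank P 0, res_rank Q 0),
    forall x, augmentation (P := Q) (x *m phi0) = augmentation (P := P) x.
  have /choice [y hy] : forall u : 'I_(res_rank P 0), exists y,
      augmentation (P := Q) y = augmentation (P := P) (row u 1%:M).
    by case: hQ => _ _ + _ _ u; apply.
  exists (\matrix_u y u) => x; rewrite -{2}[x]mulmx1 !augmentation_mul.
  by apply: eq_bigr => u _; rewrite rowK hy.
(* Sending syzygies to syzygies is the invariant that lets the next square be filled. *)
pose G i (phi : 'M[S]_(res_rank P i, res_rank Q i)) :=
  forall x, syzygy x -> syzygy (x *m phi).
pose R i (phi : 'M[S]_(res_rank P i, res_rank Q i))
    (phi' : 'M[S]_(res_rank P i.+1, res_rank Q i.+1)) :=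
  res_diff P i *m phi = phi' *m res_diff Q i.
have [|i phi Gphi|phi [phi0E comm]] := @dependent_choice _ G R phi0.
- by move=> x /= x0; rewrite aug0.
- have [u|phi' phi'E] := @factor_syzygies _ _ Q i _ (res_diff P i *m phi) hQ.
    rewrite row_mul; apply: Gphi; apply/syzygyP => //.
    by exists (delta_mx 0 u); rewrite rowE.
  exists phi' => // x /= x0.
  by rewrite -mulmxA -phi'E mulmxA x0 mul0mx.
exists (fun i => hcomp_mx (phi i)); split=> [i|i|x].
- exact: homog_hcomp_mx.
- rewrite -hcomp_mxMl -?hcomp_mxMr ?comm //; exact: homog_res_diff.
rewrite -aug0 phi0E; apply: (augmentation_eq (P := Q)) => u {x}.
(* Truncation preserves the augmentation: only target basis vectors of degree 0 contribute. For [u]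
   of degree 0 the truncation keeps constant coefficients; otherwise both sides vanish. *)
have [u0|u0] := eqVneq (res_deg u) 0.
  apply: eq_bigr => v _; rewrite !mxE.
  have [->|/res_aug_homog v0] := eqVneq (res_aug v) 0; first by rewrite !mulr0.
  by rewrite hcomp_coeff u0 v0 // mdeg0.
rewrite [RHS](_ : _ = 0).
  rewrite /augmentation big1 // => v _; rewrite !mxE.
  have [->|/res_aug_homog v0] := eqVneq (res_aug v) 0; first by rewrite !mulr0.
  rewrite hcomp_coeff v0 // subr0 mdeg0 eq_sym (negPf u0) mul0r //.
rewrite rowE aug0 /augmentation big1 // => v _; rewrite mxE eqxx /=.
have [<-|_] := eqVneq u v; last by rewrite mcoeff0 mul0r.
have [->|/res_aug_homog] := eqVneq (res_aug u) 0; first by rewrite mulr0.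
by move=> /(_ hP) u0'; rewrite u0' eqxx in u0.
Qed.

(** In contrast with [syzygy], position 0 carries no condition: Tor is computed from the complex
    without its augmentation. *)
Definition cycle P i : 'rV[S]_(res_rank P i) -> Prop :=
  match i with
  | 0 => fun _ => True
  | i'.+1 => fun x => x *m res_diff P i' = 0
  end.

Lemma cycle_row_diff P i u :
  resolves_residue_field P -> cycle (row u (res_diff P i)).
Proof.
case: i u => // i u [_ _ _ _ exactS] /=; apply/exactS.
by exists (delta_mx 0 u); rewrite rowE.
Qed.

(** On a cycle, the homotopy term passing through the differential of [P] vanishes, so a single [s]
    expresses the homotopy there. This form is enough for homology and for its own induction. *)
Lemma null_homotopic P Q (delta : forall i, 'M[S]_(res_rank P i, res_rank Q i)) :
  resolves_residue_field P -> resolves_residue_field Q ->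
  (forall i, homog_mx (delta i)) ->
  (forall i, res_diff P i *m delta i = delta i.+1 *m res_diff Q i) ->
  (forall x, augmentation (P := Q) (x *m delta 0) = 0) ->
  forall i, exists2 s : 'M[S]_(res_rank P i, res_rank Q i.+1),
    homog_mx s &
    forall z, cycle z -> z *m delta i = z *m s *m res_diff Q i.
Proof.
move=> hP hQ homd comm aug0; elim=> [|i [s hs sE]].
  have [u|B BE] := @factor_syzygies _ _ Q 0 _ (delta 0) hQ.
    by rewrite rowE /= aug0.
  exists (hcomp_mx B); first exact: homog_hcomp_mx.
  move=> z _; rewrite -mulmxA -hcomp_mxMr; last exact: homog_res_diff.
  by rewrite -BE hcomp_mx_id.
(* The rows of [E] are syzygies because the rows of [res_diff P i] are cycles, where the previous
   [s] already represents [delta i]. *)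
pose E := delta i.+1 - res_diff P i *m s.
have hE : homog_mx E.
  by apply: homog_mxB => //; apply: homog_mxM => //; apply: homog_res_diff.
have [u|B BE] := @factor_syzygies _ _ Q i.+1 _ E hQ.
  rewrite /= -row_mul mulmxBl -comm -mulmxA -mulmxBr row_mul mulmxBr.
  by rewrite sE ?mulmxA ?subrr //; apply: cycle_row_diff.
exists (hcomp_mx B); first exact: homog_hcomp_mx.
move=> z /= z0; rewrite -mulmxA -hcomp_mxMr; last exact: homog_res_diff.
by rewrite -BE hcomp_mx_id // mulmxBr mulmxA z0 mul0mx subr0.
Qed.

Section Tor.
Variables (M : S -> Prop) (hM : is_submodule M) (i : nat) (j : int).

Lemma tor_cycleP P (x : 'rV_(res_rank P i)) :
  tor_cycle M j x <-> tensor_degree M j x /\ cycle x.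
Proof. by case: i x => [|i'] x; split=> // -[]. Qed.

Lemma tensor_degree_subspace P i' :
  is_subspace (tensor_degree (P := P) M (i := i') j).
Proof.
have [M0 MD MM] := hM; split=> [l|x y hx hy l|c x hx l]; rewrite mxE.
- by split=> //; apply: in_degree0.
- have [[hMx dx] [hMy dy]] := (hx l, hy l); split; first exact: MD.
  rewrite -[y 0 l]opprK; apply: in_degreeB => //.
  by rewrite -sub0r; apply: in_degreeB => //; apply: in_degree0.
have [hMx dx] := hx l; split; first exact: MM.
exact: in_degreeC.
Qed.

Lemma tor_cycle_subspace P : is_subspace (tor_cycle (P := P) M (i := i) j).
Proof.
have [T0 TD TZ] := tensor_degree_subspace P i.
split=> [|x y /tor_cycleP[hx cx] /tor_cycleP[hy cy]|c x /tor_cycleP[hx cx]];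
  apply/tor_cycleP.
- by split=> //; case: i => //= i'; rewrite mul0mx.
- split; first exact: TD.
  by case: i x y cx cy {hx hy} => //= i' x y x0 y0; rewrite mulmxDl x0 y0 addr0.
split; first exact: TZ.
by case: i x cx {hx} => //= i' x x0; rewrite -scalemxAl x0 scaler0.
Qed.

Lemma tor_boundary_subspace P : is_subspace (tor_boundary (P := P) M (i := i) j).
Proof.
have [T0 TD TZ] := tensor_degree_subspace P i.+1.
split=> [|_ _ [x hx ->] [y hy ->]|c _ [x hx ->]].
- by exists 0; rewrite ?mul0mx.
- by exists (x + y); rewrite ?mulmxDl //; apply: TD.
by exists (c%:MP *: x); rewrite -?scalemxAl //; apply: TZ.
Qed.

Lemma tensor_degree_mul P Q i1 i2 (phi : 'M[S]_(res_rank P i1, res_rank Q i2)) x :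
  homog_mx phi -> tensor_degree (P := P) M j x ->
  tensor_degree (P := Q) M j (x *m phi).
Proof.
move=> hphi hx l; rewrite mxE; have [_ _ MM] := hM; split.
  by apply: submodule_sum => // u _; rewrite mulrC; apply: MM; apply: (hx u).1.
apply: in_degree_sum => u _.
have -> : j - res_deg l = j - res_deg u + (res_deg u - res_deg l) by lia.
by apply: in_degreeM; [apply: (hx u).2 | apply: hphi].
Qed.

Lemma cycle_chain_map P Q phi (x : 'rV_(res_rank P i)) :
  chain_map (P := P) (Q := Q) phi -> cycle x -> cycle (x *m phi i).
Proof.
case=> _ comm _; case: i x => //= i' x x0.
by rewrite -mulmxA -comm mulmxA x0 mul0mx.
Qed.

Lemma tor_cycle_chain_map P Q phi (x : 'rV_(res_rank P i)) :
  chain_map (P := P) (Q := Q) phi -> tor_cycle M j x -> tor_cycle M j (x *m phi i).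
Proof.
move=> hphi /tor_cycleP[hx cx]; apply/tor_cycleP; split.
  by apply: tensor_degree_mul => //; case: hphi.
exact: cycle_chain_map.
Qed.

Lemma tor_boundary_chain_map P Q phi (x : 'rV_(res_rank P i)) :
  chain_map (P := P) (Q := Q) phi ->
  tor_boundary M j x -> tor_boundary M j (x *m phi i).
Proof.
case=> homd comm _ [y hy ->]; exists (y *m phi i.+1).
  exact: tensor_degree_mul.
by rewrite -!mulmxA comm.
Qed.

(** The composite and the identity have the same augmentation, so their difference is null-homotopic
    and sends cycles to boundaries. *)
Lemma tor_boundary_roundtrip P Q phi psi (x : 'rV_(res_rank P i)) :
  resolves_residue_field P ->
  chain_map (P := P) (Q := Q) phi -> chain_map (P := Q) (Q := P) psi ->
  tor_cycle M j x -> tor_boundary M j (x *m phi i *m psi i - x).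
Proof.
move=> hP [phih phic phia] [psih psic psia] /tor_cycleP[hx cx].
have [|i'|y|s hs sE] := @null_homotopic P P (fun i => phi i *m psi i - 1%:M) hP hP _ _ _ i.
- move=> i'; apply: homog_mxB; last exact: homog_mx1.
  exact: homog_mxM.
- by rewrite mulmxBr mulmxBl mulmx1 mul1mx mulmxA phic -!mulmxA psic.
- have /eqP := psia (y *m phi 0); rewrite phia -subr_eq0 -mulmxA => /eqP <-.
  rewrite /augmentation -sumrB; apply: eq_bigr => l _.
  by rewrite mulmxBr mulmx1 !(@mxE _ 1) mcoeffB mulrBl.
exists (x *m s); first exact: tensor_degree_mul.
by rewrite -sE // mulmxBr mulmx1 mulmxA.
Qed.

Lemma comb_mulmx r r' b (c : 'I_b -> k) (v : 'I_b -> 'rV[S]_r) (A : 'M_(r, r')) :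
  (\sum_l (c l)%:MP *: v l) *m A = \sum_l (c l)%:MP *: (v l *m A).
Proof. by rewrite mulmx_suml; apply: eq_bigr => l _; rewrite scalemxAl. Qed.

(** The basis is transported by a comparison map [phi]; a map [psi] backwards inverts it up to
    boundaries. *)
Lemma quotient_dim_resolution P Q b :
  resolves_residue_field P -> resolves_residue_field Q ->
  quotient_dim (tor_cycle (P := P) M (i := i) j) (tor_boundary (P := P) M (i := i) j) b ->
  quotient_dim (tor_cycle (P := Q) M (i := i) j) (tor_boundary (P := Q) M (i := i) j) b.
Proof.
move=> hP hQ [v [Zv genv freev]].
have [phi hphi] := chain_map_exists hP hQ.
have [psi hpsi] := chain_map_exists hQ hP.
exists (fun l => v l *m phi i); split=> [l|z hz|c hc l].
- exact: tor_cycle_chain_map.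
- have [c hc] := genv _ (tor_cycle_chain_map hpsi hz); exists c.
  rewrite -comb_mulmx; set w := \sum_l _.
  have -> : z - w *m phi i =
      (z *m psi i - w) *m phi i - (z *m psi i *m phi i - z).
    by rewrite mulmxBl opprB [RHS]addrC addrA subrK.
  apply: subspaceB; [exact: tor_boundary_subspace|exact: tor_boundary_chain_map|].
  exact: tor_boundary_roundtrip.
apply: freev; set w := \sum_l _.
have hw : tor_cycle M j w by apply: subspace_comb => //; apply: tor_cycle_subspace.
have -> : w = w *m phi i *m psi i - (w *m phi i *m psi i - w).
  by rewrite opprB [RHS]addrC subrK.
apply: subspaceB; [exact: tor_boundary_subspace| |exact: tor_boundary_roundtrip].
by apply: tor_boundary_chain_map => //; rewrite comb_mulmx.
Qed.

End Tor.
End ComparisonTheorem.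

(** * The Koszul complex *)

Section KoszulComplex.
Variables (k : fieldType) (n : nat) (r : rel 'I_n).
Hypothesis r_tournament : forall i j, i != j -> r i j = ~~ r j i.
Notation S := {mpoly k[n]}.
Implicit Types (F G H : {set 'I_n}) (f g : {set 'I_n} -> k).

(** Parity of the number of [j] in [F] with [r j i]. The relation is a parameter so that an order
    adapted to the two shifted variables can be chosen later. *)
Definition koszul_sign i F : k := \prod_(j in F) (-1) ^+ r j i.

Lemma koszul_sign_setU1 i x F :
  x \notin F -> koszul_sign i (x |: F) = (-1) ^+ r x i * koszul_sign i F.
Proof. exact: big_setU1. Qed.

Lemma koszul_sign_sqr i F : koszul_sign i F * koszul_sign i F = 1.
Proof.
rewrite -big_split /=; apply: big1 => j _.
by rewrite -expr2 sqrr_sign.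
Qed.

(** Exactly one of [r i j] and [r j i] holds, so the two orders of removing [i] and [j] differ by
    one sign. *)
Lemma koszul_sign_exchange i j F : i != j -> i \notin F -> j \notin F ->
  koszul_sign i (i |: (j |: F)) * koszul_sign j (j |: F) =
  - (koszul_sign j (j |: (i |: F)) * koszul_sign i (i |: F)).
Proof.
move=> neij iF jF.
rewrite setUCA (koszul_sign_setU1 i (x := j)); last by rewrite !inE negb_or eq_sym neij.
rewrite setUCA (koszul_sign_setU1 j (x := i)); last by rewrite !inE negb_or neij.
rewrite (r_tournament neij); case: (r j i); rewrite /= ?expr0 ?expr1; ring.
Qed.

(* The differential and the contractions of the full simplex on 'I_n: the part of
   total multidegree alpha of the Koszul complex of S is the subcomplex of the
   faces contained in the support of alpha. *)
Definition simplex_diff f G : k :=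
  \sum_(i | i \notin G) koszul_sign i (i |: G) * f (i |: G).

Definition cone i f G : k :=
  if i \in G then koszul_sign i G * f (G :\ i) else 0.

Lemma simplex_diff_ext f g : f =1 g -> simplex_diff f =1 simplex_diff g.
Proof. by move=> fg G; apply: eq_bigr => i _; rewrite fg. Qed.

Lemma simplex_diff_comp f G : simplex_diff (simplex_diff f) G = 0.
Proof.
pose c i j := koszul_sign i (i |: G) * koszul_sign j (j |: (i |: G)) *
  f (j |: (i |: G)).
have cC i j : i != j -> i \notin G -> j \notin G -> c i j = - c j i.
  move=> neij iG jG; rewrite /c setUCA [X in X * f _]mulrC setUCA.
  by rewrite koszul_sign_exchange ?mulNr 1?eq_sym // setUCA [X in - (X * _)]mulrC setUCA.
pose Q i j := [&& i \notin G, j \notin G & i != j].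
have -> : simplex_diff (simplex_diff f) G = \sum_i \sum_(j | Q i j) c i j.
  rewrite /simplex_diff big_mkcond /=; apply: eq_bigr => i _.
  case: ifPn => iG; last by rewrite big_pred0 // => j; rewrite /Q (negPf iG).
  rewrite mulr_sumr; apply: eq_big => [j|j _]; last by rewrite mulrA.
  by rewrite !inE negb_or /Q iG eq_sym andbC.
(* The ordered pairs are split by [r]; exchanging [i] and [j] matches the two halves with opposite
   signs. *)
have -> : \sum_i \sum_(j | Q i j) c i j =
    \sum_i \sum_(j | Q i j && r i j) c i j +
    \sum_i \sum_(j | Q i j && ~~ r i j) c i j.
  by rewrite -big_split; apply: eq_bigr => i _; rewrite -bigID.
apply/eqP; rewrite addr_eq0; apply/eqP; rewrite -sumrN.
rewrite (exchange_big_dep predT) //=; apply: eq_bigr => j _.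
rewrite -sumrN; apply: eq_big => [i|i /andP[/and3P[iG jG neij] _]].
  rewrite /Q [j == i]eq_sym; case: (eqVneq i j) => [|neij]; first by rewrite !andbF.
  by rewrite r_tournament //= !andbT [_ && (i \notin G)]andbC.
exact: cC.
Qed.

(** Coning off [i] is a contracting homotopy. If [i] is not in [G], only the term of [i] survives;
    if it is, that term gives [f G] and the others cancel by the exchange of signs. *)
Lemma simplex_diff_cone i f G :
  simplex_diff (cone i f) G + cone i (simplex_diff f) G = f G.
Proof.
rewrite /cone; case: ifPn => iG; last first.
  rewrite addr0 /simplex_diff (bigD1 i) //= setU11 setU1K // mulrA.
  rewrite koszul_sign_sqr mul1r big1 ?addr0 // => j /andP[jG neji].
  by rewrite !inE eq_sym (negPf neji) (negPf iG) mulr0.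
rewrite /simplex_diff mulr_sumr [X in _ + X](bigD1 i) ?setD11 //=.
rewrite setD1K // mulrA koszul_sign_sqr mul1r addrCA -[RHS]addr0; congr (_ + _).
rewrite [X in _ + X](eq_bigl (fun j => j \notin G)); last first.
  by move=> j; rewrite !inE; case: eqVneq => [->|]; rewrite ?iG ?andbT.
rewrite -big_split big1 //= => j jG.
have neij : i != j by apply: contraNneq jG => <-.
rewrite !inE iG orbT.
set H := G :\ i; have iH : i \notin H by rewrite setD11.
have jH : j \notin H by rewrite !inE (negPf jG) andbF.
have -> : (j |: G) :\ i = j |: H.
  by apply/setP=> x; rewrite !inE; case: (eqVneq x j) => [->|//]; rewrite eq_sym neij.
have GE : G = i |: H by rewrite setD1K.
rewrite !mulrA -mulrDl; move: (koszul_sign_exchange neij iH jH).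
rewrite -GE [i |: (j |: H)]setUCA -GE.
set a := koszul_sign i (j |: G); set b := koszul_sign j (j |: H).
set c := koszul_sign j (j |: G); set d := koszul_sign i G => ab.
suff -> : c * a + d * b = 0 by rewrite mul0r.
(* The exchange relation involves [a * b], so the factor [b * b = 1] is inserted. *)
have -> : c * a = c * (a * b) * b by rewrite mulrA -mulrA koszul_sign_sqr mulr1.
by rewrite ab mulrN mulrA koszul_sign_sqr; ring.
Qed.

End KoszulComplex.

(** * The Koszul complex resolves the residue field *)

Section KoszulResolution.
Variables (k : fieldType) (n : nat) (r : rel 'I_n).
Hypothesis r_tournament : forall i j, i != j -> r i j = ~~ r j i.
Notation S := {mpoly k[n]}.
Implicit Types (F G : {set 'I_n}) (al : 'X_{1..n}).

Definition face i := {F : {set 'I_n} | #|F| == i}.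

(** Free modules are indexed by ordinals in [free_complex]; this recovers the face of a basis
    vector. *)
Definition label i (l : 'I_#|{: face i}|) : {set 'I_n} := val (enum_val l).

Lemma label_inj i : injective (@label i).
Proof. by move=> l l' /val_inj /enum_val_inj. Qed.

Lemma card_label i (l : 'I_#|{: face i}|) : #|label l| = i.
Proof. exact/eqP/(valP (enum_val l)). Qed.

Lemma label_surj i F : #|F| = i -> exists l : 'I_#|{: face i}|, label l = F.
Proof.
move=> /eqP hF; exists (enum_rank (exist _ F hF : face i)).
by rewrite /label enum_rankK.
Qed.

(** At most one term of each sum is nonzero, for the vertex [x] that completes [label v] to
    [label u]. *)
Definition koszul_diff i : 'M[S]_(#|{: face i.+1}|, #|{: face i}|) :=
  \matrix_(u, v) \sum_(x | x \notin label v)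
    if label u == x |: label v then koszul_sign k r x (label u) *: 'X_x else 0.

Definition koszul : free_complex k n :=
  FreeComplex (fun i (_ : 'I_#|{: face i}|) => i%:Z) koszul_diff (fun _ => 1).

Lemma mesym1_setU1 x G :
  x \notin G -> mesym1 (x |: G) = (U_(x) + mesym1 G)%MM.
Proof.
move=> xG; apply/mnmP => y; rewrite mnmDE mnm1E !mnmE !inE eq_sym.
by case: eqVneq => //= <-; rewrite (negPf xG).
Qed.

Lemma mcoeffMX_if (p : S) m al :
  (p * 'X_[m])@_al = if (m <= al)%MM then p@_(al - m) else 0.
Proof.
case: ifPn => [/submK {1}<-|lemal]; first by rewrite addmC mcoeffMX.
apply: memN_msupp_eq0; apply: contra lemal.
rewrite (perm_mem (msuppMX p m)) => /mapP[m' _ ->]; exact: lem_addr.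
Qed.

(* Multiplying the F-component by 'X_[mesym1 F] turns the multidegree of the
   coefficient into the total multidegree al, which the differential preserves. *)
Definition face_coef i (x : 'rV[S]_#|{: face i}|) al F : k :=
  \sum_l if label l == F then (x 0 l * 'X_[mesym1 F])@_al else 0.

Lemma face_coef_label i (x : 'rV[S]_#|{: face i}|) al l :
  face_coef x al (label l) = (x 0 l * 'X_[mesym1 (label l)])@_al.
Proof.
rewrite /face_coef (bigD1 l) //= eqxx big1 ?addr0 // => l' nel.
by rewrite (inj_eq (@label_inj i)) (negPf nel).
Qed.

Lemma face_coef_card i (x : 'rV[S]_#|{: face i}|) al F :
  #|F| != i -> face_coef x al F = 0.
Proof.
move=> hF; apply: big1 => l _; case: eqP => // lF.
by rewrite -lF card_label eqxx in hF.
Qed.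

Lemma face_coef_neq0 i (x : 'rV[S]_#|{: face i}|) al F : face_coef x al F != 0 ->
  exists l, [/\ label l = F, (mesym1 F <= al)%MM & (x 0 l)@_(al - mesym1 F) != 0].
Proof.
have [/label_surj [l <-]|/face_coef_card ->] := eqVneq #|F| i; last by rewrite eqxx.
rewrite face_coef_label mcoeffMX_if; case: ifP => h; last by rewrite eqxx.
by exists l.
Qed.

Lemma face_coef_inj i (x y : 'rV[S]_#|{: face i}|) :
  (forall al F, face_coef x al F = face_coef y al F) -> x = y.
Proof.
move=> exy; apply/rowP => l; apply/mpolyP => m.
move: (exy (mesym1 (label l) + m)%MM (label l)).
by rewrite !face_coef_label !mcoeffMX.
Qed.

Lemma face_coefB i (x y : 'rV[S]_#|{: face i}|) al F :
  face_coef (x - y) al F = face_coef x al F - face_coef y al F.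
Proof.
rewrite /face_coef -sumrB; apply: eq_bigr => l _; rewrite !mxE mulrBl mcoeffB.
by case: ifP => //; rewrite subr0.
Qed.

(** The variable in a matrix entry is exactly what turns the monomial of the smaller face into that
    of the larger one, so total multidegrees separate. *)
Lemma face_coef_diff i (y : 'rV[S]_#|{: face i.+1}|) al G :
  face_coef (y *m koszul_diff i) al G = simplex_diff r (face_coef y al) G.
Proof.
have [/label_surj [v <-]|hG] := eqVneq #|G| i; last first.
  rewrite face_coef_card // /simplex_diff big1 // => x xG.
  by rewrite face_coef_card ?mulr0 // cardsU1 xG.
rewrite face_coef_label !mxE mulr_suml (raddf_sum (mcoeff al)) /=.
rewrite /simplex_diff /face_coef.
under [RHS]eq_bigr do rewrite mulr_sumr.
rewrite exchange_big /=; apply: eq_bigr => u _.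
rewrite mxE mulr_sumr mulr_suml (raddf_sum (mcoeff al)) /=.
apply: eq_bigr => x xv; case: eqP => [->|_]; last by rewrite mulr0 mul0r mcoeff0 mulr0.
by rewrite -scalerAr -scalerAl mcoeffZ mesym1_setU1 // mpolyXD mulrA.
Qed.

(** Inverse of [face_coef]; the degree bound [N] keeps the sum finite. *)
Definition row_of_coef i N (f : 'X_{1..n} -> {set 'I_n} -> k) :
    'rV[S]_#|{: face i}| :=
  \row_l \sum_(al : 'X_{1..n < N}) f al (label l) *: 'X_[al - mesym1 (label l)].

Lemma row_of_coefK i N (f : 'X_{1..n} -> {set 'I_n} -> k) :
  (forall al F, f al F != 0 ->
     [/\ (mesym1 F <= al)%MM, (mdeg al < N)%N & #|F| = i]) ->
  forall al F, face_coef (row_of_coef i N f) al F = f al F.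
Proof.
move=> hf al F; have [/label_surj [l <-]|hF] := eqVneq #|F| i; last first.
  rewrite face_coef_card //; apply/esym/eqP/negPn/negP => /hf [_ _ cF].
  by rewrite cF eqxx in hF.
rewrite face_coef_label mxE mulr_suml (raddf_sum (mcoeff al)) /=.
have termE (be : 'X_{1..n < N}) :
    (f be (label l) *: 'X_[be - mesym1 (label l)] * 'X_[mesym1 (label l)])@_al =
    if al == be then f be (label l) else 0.
  rewrite -scalerAl -mpolyXD mcoeffZ mcoeffX.
  have [->|/hf [/submK -> _ _]] := eqVneq (f be (label l)) 0.
    by rewrite mul0r if_same.
  by rewrite eq_sym; case: ifP; rewrite ?mulr1 ?mulr0.
under eq_bigr do rewrite termE.
have [f0|/hf [_ ltN _]] := eqVneq (f al (label l)) 0.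
  by rewrite f0 big1 // => be _; case: eqP => // <-.
rewrite (bigD1 (BMultinom ltN)) //= eqxx big1 ?addr0 // => be nebe.
by case: eqP => // albe; case/eqP: nebe; apply/val_inj.
Qed.

Lemma koszul_diff_comp i : koszul_diff i.+1 *m koszul_diff i = 0.
Proof.
apply/row_matrixP => u; rewrite row_mul row0; apply: face_coef_inj => al F.
rewrite face_coef_diff (simplex_diff_ext r (g := simplex_diff r (face_coef (row u 1%:M) al))).
  rewrite simplex_diff_comp // -[0 in RHS](subrr 0) face_coefB subrr //.
by move=> G; rewrite -face_coef_diff -row_mul mul1mx.
Qed.

Lemma mesym1_le0 F : (mesym1 F <= 0)%MM = (F == set0).
Proof.
apply/mnm_lepP/eqP => [h|-> i]; last by rewrite mesym1_set0.
apply/setP => i; rewrite inE; move: (h i); rewrite !mnmE.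
by case: (_ \in _).
Qed.

(** In a nonzero multidegree, coning off a vertex of its support stays within the allowed faces and
    contracts. In multidegree 0 only the empty face occurs, and the second hypothesis handles it. *)
Lemma koszul_exact i (x : 'rV[S]_#|{: face i}|) :
  (forall al G, simplex_diff r (face_coef x al) G = 0) ->
  face_coef x 0%MM set0 = 0 -> exists y, x = y *m koszul_diff i.
Proof.
move=> cx x0.
pose f al F := if [pick j | al j != 0%N] is Some j
  then cone r j (face_coef x al) F else 0.
(* A multidegree occurring in [x] is a monomial of some entry times a face of [i] variables, so its
   degree stays below this bound. *)
pose N := (\sum_l msize (x 0%R l) + i)%N.
have fP al F : f al F != 0 ->
    [/\ (mesym1 F <= al)%MM, (mdeg al < N)%N & #|F| = i.+1].
  rewrite /f; case: pickP => [j alj|_]; last by rewrite eqxx.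
  rewrite /cone; case: ifP => jF; last by rewrite eqxx.
  rewrite mulf_eq0 negb_or => /andP[_ /face_coef_neq0 [l [lF le_al nz]]].
  have cF : #|F :\ j| = i by rewrite -lF card_label.
  split; last by rewrite (cardsD1 j F) jF cF.
    apply/mnm_lepP => j'; move/mnm_lepP/(_ j'): le_al; rewrite !mnmE !inE.
    by have [->|] := eqVneq j' j; rewrite //= jF lt0n.
  rewrite -(submK le_al) mdegD mdeg_mesym1 cF /N ltn_add2r.
  move: nz; rewrite -mcoeff_msupp => /msize_mdeg_lt /leq_trans; apply.
  by rewrite (bigD1 l) //= leq_addr.
exists (row_of_coef i.+1 N f); apply: face_coef_inj => al G.
rewrite face_coef_diff (simplex_diff_ext r (row_of_coefK fP al)).
rewrite /f /=; case: pickP => [j _|al0].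
  rewrite -[LHS](simplex_diff_cone r_tournament j) [cone _ _ (simplex_diff _ _) _](_ : _ = 0).
    by rewrite addr0.
  by rewrite /cone cx mulr0 if_same.
rewrite [RHS]big1 => [|j _]; last by rewrite mulr0.
have -> : al = 0%MM by apply/mnmP => j; rewrite mnm0E; apply/eqP/negPn; rewrite al0.
have [->//|G0] := eqVneq G set0.
apply/eqP/negPn/negP => /face_coef_neq0 [l [_]].
by rewrite mesym1_le0 (negPf G0).
Qed.

Lemma koszul_augmentation x : augmentation (P := koszul) x = face_coef x 0%MM set0.
Proof.
have [l l0] := label_surj (cards0 'I_n).
rewrite -[in RHS]l0 face_coef_label l0 mesym1_set0 mpolyX0 mulr1 /augmentation.
rewrite (bigD1 l) //= mulr1 big1 ?addr0 // => l' /eqP[]; apply: label_inj.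
by rewrite l0; apply/cards0_eq/card_label.
Qed.

Lemma koszul_resolves : resolves_residue_field koszul.
Proof.
split=> [i u v|//|c|x|i x] /=.
- rewrite mxE; apply: in_degree_sum => x _; case: eqP => _; last exact: in_degree0.
  apply/in_degreeP => m; rewrite mcoeffZ mcoeffX.
  have [<- _|_] := eqVneq U_(x)%MM m; last by rewrite mulr0 eqxx.
  by rewrite mdeg1; lia.
- exists (const_mx c%:MP); rewrite koszul_augmentation.
  have [l l0] := label_surj (cards0 'I_n).
  by rewrite -l0 face_coef_label l0 mesym1_set0 mpolyX0 mulr1 mxE mcoeffC eqxx mulr1.
- split=> [|[y ->]].
    rewrite koszul_augmentation; apply: koszul_exact => al G.
    apply: big1 => j jG; rewrite face_coef_card ?mulr0 //.
    by rewrite cardsU1 jG.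
  rewrite koszul_augmentation face_coef_diff; apply: big1 => j j0.
  apply/eqP; rewrite mulf_eq0; apply/orP; right.
  apply/negPn/negP => /face_coef_neq0 [l [_]]; rewrite mesym1_le0.
  by rewrite setU0 -cards_eq0 cards1.
split=> [x0|[y ->]]; last by rewrite -mulmxA koszul_diff_comp mulmx0.
apply: koszul_exact => [al G|]; last by rewrite face_coef_card // cards0.
rewrite -face_coef_diff x0 -[0 in LHS](subrr 0) face_coefB subrr //.
Qed.

End KoszulResolution.

Section QuotientDimVspace.
Variables (k : fieldType) (n r : nat) (V : vectType k).
Notation S := {mpoly k[n]}.
Variables (Z B : 'rV[S]_r -> Prop) (psi : 'rV[S]_r -> V) (theta : V -> 'rV[S]_r).
Variables ZV BV : {vspace V}.

(** Transfers the count to finite-dimensional linear algebra: a basis of a complement of [BV] in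
    [ZV] is pulled back by [theta], and [psi] tests membership in [B]. *)
Lemma quotient_dim_vspace :
  is_subspace Z ->
  (forall x y, psi (x - y) = psi x - psi y) ->
  (forall b (c : 'I_b -> k) x,
     psi (\sum_l (c l)%:MP *: x l) = \sum_l c l *: psi (x l)) ->
  (forall x, Z x -> psi x \in ZV) ->
  (forall x, Z x -> (B x <-> psi x \in BV)) ->
  (forall z, z \in ZV -> Z (theta z)) ->
  (forall z, z \in ZV -> psi (theta z) = z) ->
  (BV <= ZV)%VS ->
  quotient_dim Z B (\dim ZV - \dim BV).
Proof.
move=> hZ psiB psi_comb psiZ psi_B thetaZ thetaK leBZ.
pose U := (ZV :\: BV)%VS.
have <- : \dim U = (\dim ZV - \dim BV)%N.
  by rewrite -(dimv_cap_compl ZV BV) (capv_idPr leBZ) addKn.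
have UZ l : (vbasis U)`_l \in ZV.
  have [lt|ge] := ltnP l (\dim U); last by rewrite nth_default ?size_tuple // mem0v.
  apply: (subvP (diffvSl _ _)); apply: vbasis_mem; apply: mem_nth.
  by rewrite size_tuple.
have Zv l : Z (theta (vbasis U)`_l) by apply: thetaZ.
exists (fun l => theta (vbasis U)`_l); split=> // [z hz|c hc].
  have : psi z \in (U + BV)%VS.
    by rewrite addv_diff (subvP (addvSl _ _)) // psiZ.
  case/memv_addP => u hu [b hb zE].
  exists (fun l => coord (vbasis U) l u).
  apply/psi_B; first by apply: subspaceB => //; apply: subspace_comb.
  rewrite psiB psi_comb zE {1}(coord_vbasis hu).
  under [X in _ - X]eq_bigr do rewrite thetaK //.
  by rewrite addrAC subrr add0r.
have /freeP free_U := basis_free (vbasisP U); apply: free_U.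
apply/eqP; rewrite -memv0 -(capv_diff ZV BV) memv_cap; apply/andP; split.
  by apply: memv_suml => l _; rewrite memvZ // vbasis_mem // mem_nth // size_tuple.
have /psi_B [/(_ hc) + _] : Z (\sum_l (c l)%:MP *: theta (vbasis U)`_l).
  exact: subspace_comb.
by rewrite psi_comb; under eq_bigr do rewrite thetaK //.
Qed.

End QuotientDimVspace.

(** * Betti numbers as dimensions of Koszul homology *)

Section CoordinateSubspace.
Variables (k : fieldType) (T : finType).
Notation V := {ffun T -> k^o}.

Definition coord_cut (w : pred T) (x : V) : V := [ffun u => if w u then 0 else x u].

Fact coord_cut_is_linear w : linear (coord_cut w).
Proof.
by move=> c x y; apply/ffunP => u; rewrite !ffunE; case: ifP => // _; rewrite scaler0 addr0.
Qed.

HB.instance Definition _ w :=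
  GRing.isLinear.Build k V V _ (coord_cut w) (coord_cut_is_linear w).

(** Vectors supported in [w], as the kernel of the map erasing those coordinates. *)
Definition coord_space (w : pred T) : {vspace V} := lker (linfun (coord_cut w)).

Lemma coord_spaceP (w : pred T) (x : V) :
  reflect (forall u, x u != 0 -> w u) (x \in coord_space w).
Proof.
rewrite memv_ker lfunE /=; apply: (iffP eqP) => [x0 u|hx].
  by move/ffunP/(_ u): x0; rewrite !ffunE; case: (w u) => // ->; rewrite eqxx.
apply/ffunP => u; rewrite !ffunE; case: ifP => // /negP wu.
by apply/eqP/negPn/negP => /hx.
Qed.

End CoordinateSubspace.

Section BettiDimension.
Variables (k : fieldType) (n : nat) (r : rel 'I_n).
Hypothesis r_tournament : forall i j, i != j -> r i j = ~~ r j i.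
Variable N : nat.
Notation S := {mpoly k[n]}.
(** Bounding the degree makes the index set finite. All homological positions share one space, so
    the differential is an endomorphism. *)
Definition chain_index : finType := ('X_{1..n < N} * {set 'I_n})%type.
Notation V := {ffun chain_index -> k^o}.

Definition chain_diff_fun (x : V) : V :=
  [ffun u => simplex_diff r (fun F => x (u.1, F)) u.2].

Fact chain_diff_is_linear : linear chain_diff_fun.
Proof.
move=> c x y; apply/ffunP => u; rewrite !ffunE /simplex_diff scaler_sumr -big_split.
by apply: eq_bigr => i _; rewrite !ffunE mulrDr /= scalerAr.
Qed.

HB.instance Definition _ :=
  GRing.isLinear.Build k V V _ chain_diff_fun chain_diff_is_linear.

Definition chain_diff : 'End(V) := linfun chain_diff_fun.

(** The first component is the total multidegree, so the coefficient monomial is its difference with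
    the face. The first condition keeps this subtraction from being truncated. *)
Definition chain_weight (A : pred 'X_{1..n}) i (j : int) (u : chain_index) :=
  [&& (mesym1 u.2 <= u.1)%MM, A (u.1 - mesym1 u.2)%MM, #|u.2| == i &
      (mdeg u.1)%:Z == j].

Definition chain_space A i j : {vspace V} := coord_space k (chain_weight A i j).

Definition koszul_dim A i j : nat :=
  (\dim (chain_space A i j :&: lker chain_diff)
   - \dim (chain_diff @: chain_space A i.+1 j))%N.

Variables (M : S -> Prop) (A : pred 'X_{1..n}) (j : int).
Hypothesis MA : forall f, M f <-> forall m, f@_m != 0 -> A m.
Hypothesis A_up : forall m m', A m -> A (m + m')%MM.
Hypothesis lt_jN : (`|j| < N)%N.

Notation K := (koszul k r).

Lemma monomial_submodule : is_submodule M.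
Proof.
split=> [|f g /MA hf /MA hg|f g /MA hg]; apply/MA => m.
- by rewrite mcoeff0 eqxx.
- rewrite mcoeffD; have [->|/hf //] := eqVneq f@_m 0.
  by rewrite add0r => /hg.
rewrite -mcoeff_msupp => /msuppM_le /allpairsP[[m1 m2] /= [_ h2 ->]].
by rewrite addmC; apply: A_up; apply: hg; rewrite -mcoeff_msupp.
Qed.

Lemma koszul_tensor_degreeP i (x : 'rV[S]_(res_rank K i)) :
  tensor_degree (P := K) M j x <->
  forall al F, face_coef x al F != 0 ->
    A (al - mesym1 F)%MM && ((mdeg al)%:Z == j).
Proof.
split=> [hx al F /face_coef_neq0 [l [lF le_al nz]]|hx l].
  have [/MA hM /in_degreeP hd] := hx l; rewrite hM //=.
  move/(_ _ nz): hd; rewrite -[in mdeg al](submK le_al) mdegD mdeg_mesym1 -lF card_label.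
  by move=> /= hd; apply/eqP; move: hd; lia.
have hm m : (x 0 l)@_m != 0 -> A m && ((mdeg m)%:Z == j - i%:Z).
  move=> nz; have := hx (mesym1 (label l) + m)%MM (label l).
  rewrite face_coef_label mcoeffMX addmC addmK => /(_ nz) /andP[-> /eqP].
  rewrite mdegD mdeg_mesym1 card_label => dE; apply/eqP; move: dE; lia.
split; first by apply/MA => m /hm /andP[].
by apply/in_degreeP => m /hm /andP[_ /eqP].
Qed.

Definition chain_of_row i (x : 'rV[S]_#|{: face n i}|) : V :=
  [ffun u : chain_index => face_coef x u.1 u.2].

Definition chain_ext (z : V) al F : k :=
  if insub al is Some be then z (be, F) else 0.

Definition row_of_chain i (z : V) : 'rV[S]_#|{: face n i}| :=
  row_of_coef i N (chain_ext z).

Lemma chain_ext_neq0 (z : V) al F : chain_ext z al F != 0 ->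
  exists2 be : 'X_{1..n < N}, al = be & z (be, F) != 0.
Proof.
rewrite /chain_ext; case: insubP => [be _ <- h|_]; last by rewrite eqxx.
by exists be.
Qed.

Lemma face_coef_row_of_chain i z al F : z \in chain_space A i j ->
  face_coef (row_of_chain i z) al F = chain_ext z al F.
Proof.
move/coord_spaceP => hz; apply: row_of_coefK => {al F} al F.
case/chain_ext_neq0 => be -> /hz /and4P[h1 _ /eqP h2 _]; split=> //.
exact: bmdeg.
Qed.

Lemma row_of_chainK i z : z \in chain_space A i j ->
  chain_of_row (row_of_chain i z) = z.
Proof.
move=> hz; apply/ffunP => -[be F]; rewrite ffunE face_coef_row_of_chain //.
by rewrite /chain_ext valK.
Qed.

Lemma tensor_degree_row_of_chain i z : z \in chain_space A i j ->
  tensor_degree (P := K) M j (row_of_chain i z).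
Proof.
move=> hz; apply/koszul_tensor_degreeP => al F.
rewrite face_coef_row_of_chain // => /chain_ext_neq0 [be -> /(coord_spaceP _ _ hz)].
by case/and4P => _ -> _ ->.
Qed.

Lemma chain_of_row_space i (x : 'rV_(res_rank K i)) :
  tensor_degree (P := K) M j x -> chain_of_row x \in chain_space A i j.
Proof.
move/koszul_tensor_degreeP => hx; apply/coord_spaceP => -[be F]; rewrite ffunE /= => nz.
have /andP[hA hj] := hx _ _ nz; rewrite /chain_weight /= hA hj.
have [l [<- -> _]] := face_coef_neq0 nz.
by rewrite card_label eqxx.
Qed.

Lemma chain_of_row_inj i (x y : 'rV_(res_rank K i)) :
  tensor_degree (P := K) M j x -> tensor_degree (P := K) M j y ->
  chain_of_row x = chain_of_row y -> x = y.
Proof.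
move=> /koszul_tensor_degreeP hx /koszul_tensor_degreeP hy /ffunP exy.
apply: face_coef_inj => al F; have [lt|ge] := ltnP (mdeg al) N.
  by have := exy (BMultinom lt, F); rewrite !ffunE.
(* Multidegrees beyond the bound carry no coefficient: they would have degree [j], and [|j| < N]. *)
have big0 (z : 'rV_(res_rank K i)) : (forall al F, face_coef z al F != 0 ->
    A (al - mesym1 F)%MM && ((mdeg al)%:Z == j)) -> face_coef z al F = 0.
  move=> hz; apply/eqP/negPn/negP => /hz /andP[_ /eqP jE].
  by move: lt_jN ge; rewrite -jE; lia.
by rewrite !big0.
Qed.

Lemma chain_of_row_diff i (y : 'rV_(res_rank K i.+1)) :
  chain_of_row (y *m res_diff K i) = chain_diff (chain_of_row y).
Proof.
rewrite /chain_diff lfunE /=; apply/ffunP => -[al G]; rewrite !ffunE face_coef_diff /=.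
by apply: simplex_diff_ext => F; rewrite ffunE.
Qed.

Lemma chain_of_rowB i (x y : 'rV_(res_rank K i)) :
  chain_of_row (x - y) = chain_of_row x - chain_of_row y.
Proof. by apply/ffunP => u; rewrite !ffunE face_coefB. Qed.

Lemma chain_of_row_comb i b (c : 'I_b -> k) (x : 'I_b -> 'rV_(res_rank K i)) :
  chain_of_row (\sum_l (c l)%:MP *: x l) = \sum_l c l *: chain_of_row (x l).
Proof.
apply/ffunP => u; rewrite sum_ffunE ffunE /face_coef.
under [RHS]eq_bigr do rewrite !ffunE scaler_sumr.
rewrite exchange_big /=; apply: eq_bigr => v _.
case: ifP => _; last by rewrite big1 // => l _; rewrite scaler0.
rewrite summxE mulr_suml (raddf_sum (mcoeff u.1)); apply: eq_bigr => l _.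
by rewrite mxE -mulrA; apply: mcoeffCM.
Qed.

Lemma koszul_tensor_degree_diff i (x : 'rV_(res_rank K i.+1)) :
  tensor_degree (P := K) M j x ->
  tensor_degree (P := K) M j (x *m res_diff K i).
Proof.
apply: (@tensor_degree_mul _ _ _ monomial_submodule j K K _ _ (res_diff K i)).
exact: homog_res_diff (koszul_resolves _ r_tournament).
Qed.

Lemma koszul_cycleP i (x : 'rV_(res_rank K i)) :
  tensor_degree (P := K) M j x ->
  cycle (P := K) x <-> chain_of_row x \in lker chain_diff.
Proof.
case: i x => [|i] x hx; rewrite memv_ker.
  (* In position 0 the condition is vacuous, and the chain is killed as well: its coefficients live
     on the empty face only. *)
  split=> // _; rewrite lfunE /=; apply/eqP/ffunP => -[al G]; rewrite !ffunE.
  apply: big1 => i iG; rewrite ffunE face_coef_card ?mulr0 //=.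
  by rewrite cardsU1 iG.
rewrite -chain_of_row_diff /=; have [T0 _ _] := tensor_degree_subspace monomial_submodule j K i.
have c0 : chain_of_row (0 : 'rV_(res_rank K i)) = 0.
  by rewrite -[X in chain_of_row X](subrr 0) chain_of_rowB subrr.
split=> [->|/eqP x0]; first by rewrite c0.
apply: chain_of_row_inj => //; last by rewrite c0.
exact: koszul_tensor_degree_diff hx.
Qed.

Lemma koszul_boundaryP i (x : 'rV_(res_rank K i)) :
  tensor_degree (P := K) M j x ->
  tor_boundary M j x <-> chain_of_row x \in (chain_diff @: chain_space A i.+1 j)%VS.
Proof.
move=> hx; split=> [[y hy ->]|/memv_imgP[w hw xE]].
  by rewrite chain_of_row_diff memv_img // chain_of_row_space.
have hy := tensor_degree_row_of_chain hw; exists (row_of_chain i.+1 w) => //.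
apply: chain_of_row_inj => //; last by rewrite chain_of_row_diff row_of_chainK.
exact: koszul_tensor_degree_diff hy.
Qed.

Lemma betti_koszul_dim i : betti M i j = koszul_dim A i j.
Proof.
have hK := koszul_resolves k r_tournament; have hM := monomial_submodule.
have dimK : quotient_dim (tor_cycle (P := K) M (i := i) j)
    (tor_boundary (P := K) M (i := i) j) (koszul_dim A i j).
  apply: (@quotient_dim_vspace _ _ _ _ _ _ (@chain_of_row i) (row_of_chain i)).
  - exact: tor_cycle_subspace.
  - exact: chain_of_rowB.
  - exact: chain_of_row_comb.
  - move=> x /tor_cycleP[hx /(koszul_cycleP hx) cx].
    by rewrite memv_cap chain_of_row_space.
  - by move=> x /tor_cycleP[hx _]; apply: koszul_boundaryP.
  - move=> z /memv_capP[hz cz]; apply/tor_cycleP.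
    have hx := tensor_degree_row_of_chain hz; split=> //.
    by apply/(koszul_cycleP hx); rewrite row_of_chainK.
  - by move=> z /memv_capP[hz _]; rewrite row_of_chainK.
  apply/subvP => _ /memv_imgP[w hw ->].
  have hy := tensor_degree_row_of_chain hw.
  have hx : tensor_degree (P := K) M j (row_of_chain i.+1 w *m res_diff K i).
    exact: koszul_tensor_degree_diff hy.
  rewrite -(row_of_chainK hw) -chain_of_row_diff memv_cap chain_of_row_space //=.
  apply/koszul_cycleP => //; case: (i) => //= i'.
  by rewrite -mulmxA koszul_diff_comp ?mulmx0.
(* The value chosen by [epsilon] comes from some resolution [P]; it is carried to the Koszul
   complex, where the dimension is unique. *)
have [P hP dimP] : tor_dim M i j (betti M i j).
  by apply: epsilon_spec; exists (koszul_dim A i j), K.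
have {}dimP := quotient_dim_resolution hM hP hK dimP.
have hB := tor_boundary_subspace hM i j K.
by apply/eqP; rewrite eqn_leq (quotient_dim_le hB dimP dimK) (quotient_dim_le hB dimK dimP).
Qed.

End BettiDimension.

(** * Folding along the swap of two variables *)

Section RankComparison.
Variables (k : fieldType) (V : vectType k) (d pi : 'End(V)) (WA WB : {vspace V}).

(** Rank-nullity for [pi] on each space, compared term by term. *)
Lemma dim_le_of_projection :
  (pi @: WA <= pi @: WB)%VS -> (forall x, x \in WA -> pi x = 0 -> x \in WB) ->
  (\dim WA <= \dim WB)%N.
Proof.
move=> piAB kerAB; rewrite -(limg_ker_dim pi WA) -(limg_ker_dim pi WB).
apply: leq_add; last exact: dimvS.
apply/dimvS/subvP => x /memv_capP[xA x0]; rewrite memv_cap x0 andbT.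
by apply: kerAB => //; apply/eqP; rewrite -memv_ker.
Qed.

Hypothesis pi_d : forall x, pi (d x) = d (pi x).

(* Under pi the image d WB maps into that of d WA, and the kernel part of d WB lies
   in d WA since 1 - pi maps WB into WA. *)
Lemma rank_le_of_projection :
  (pi @: WB <= pi @: WA)%VS -> (forall x, x \in WB -> x - pi x \in WA) ->
  (\dim (d @: WB) <= \dim (d @: WA))%N.
Proof.
move=> piBA subBA.
rewrite -(limg_ker_dim pi (d @: WB)) -(limg_ker_dim pi (d @: WA)).
apply: leq_add; apply/dimvS/subvP.
  move=> _ /memv_capP[/memv_imgP[x xB ->]]; rewrite memv_ker => /eqP x0.
  rewrite memv_cap memv_ker x0 eqxx andbT.
  by rewrite -[d x]subr0 -x0 pi_d -linearB memv_img // subBA.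
move=> _ /memv_imgP[_ /memv_imgP[x xB ->] ->]; rewrite pi_d.
have /memv_imgP[y yA ->] := subvP piBA _ (memv_img pi xB).
by rewrite -pi_d !memv_img.
Qed.

End RankComparison.

(** * Swapping and folding two vertices of the simplex *)

Section SwapFaces.
Variables (k : fieldType) (n : nat) (p q : 'I_n).
Hypothesis neq_pq : p != q.
Implicit Types (F G : {set 'I_n}) (f : {set 'I_n} -> k).

Lemma neq_qp : q != p. Proof. by rewrite eq_sym. Qed.

(* p comes first and q second, so that the transposition of p and q changes the
   sign of a face only if it contains both. *)
Definition before (i j : 'I_n) : bool :=
  if i == p then j != p else if j == p then false else
  if i == q then j != q else if j == q then false else (i < j)%N.

Lemma before_tournament i j : i != j -> before i j = ~~ before j i.
Proof.
move=> neij; rewrite /before.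
have [ip|ip] := eqVneq i p; first by rewrite -ip eq_sym (negPf neij).
have [//|jp] := eqVneq j p.
have [iq|iq] := eqVneq i q; first by rewrite -iq eq_sym (negPf neij).
have [//|jq] := eqVneq j q.
by rewrite -leqNgt ltn_neqAle (inj_eq val_inj) neij.
Qed.

Definition swap_face F : {set 'I_n} := [set i | tperm p q i \in F].

Lemma in_swap_face i F : (i \in swap_face F) = (tperm p q i \in F).
Proof. by rewrite inE. Qed.

Lemma swap_faceK : involutive swap_face.
Proof. by move=> F; apply/setP => i; rewrite !inE tpermK. Qed.

Lemma swap_faceU1 i F : swap_face (i |: F) = tperm p q i |: swap_face F.
Proof. by apply/setP => j; rewrite !inE (can2_eq (tpermK _ _) (tpermK _ _)). Qed.

Lemma card_swap_face F : #|swap_face F| = #|F|.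
Proof. exact/card_preimset/perm_inj. Qed.

Lemma swap_face_id F : (p \in F) = (q \in F) -> swap_face F = F.
Proof. by move=> pqF; apply/setP => i; rewrite inE; case: tpermP => [->|->|]. Qed.

Definition swap_sign F : k := (-1) ^+ ((p \in F) && (q \in F)).

Lemma swap_sign_sqr F : swap_sign F * swap_sign F = 1.
Proof. by rewrite -expr2 sqrr_sign. Qed.

Lemma swap_sign_swap F : swap_sign (swap_face F) = swap_sign F.
Proof. by rewrite /swap_sign !inE tpermL tpermR andbC. Qed.

(** As [p] and [q] are the first two elements, exchanging them reverses only their mutual
    comparison. *)
Lemma before_tperm i j : before (tperm p q j) (tperm p q i) =
  before j i (+) ((j == p) && (i == q) || (j == q) && (i == p)).
Proof.
rewrite /before; have npq := negPf neq_pq; have nqp := negPf neq_qp.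
case: (tpermP p q j) => [->|->|/eqP/negPf jp /eqP/negPf jq];
  case: (tpermP p q i) => [->|->|/eqP/negPf ip /eqP/negPf iq];
  rewrite ?eqxx ?npq ?nqp ?jp ?jq ?ip ?iq ?eqxx //= ?addbF //.
Qed.

(** The reversed comparison counts when [i] is one of [p], [q] and the face contains the other,
    which is exactly when adding [i] changes [swap_sign]. *)
Lemma koszul_sign_swap i G : i \notin G ->
  swap_sign G * koszul_sign k before (tperm p q i) (swap_face (i |: G)) =
  koszul_sign k before i (i |: G) * swap_sign (i |: G).
Proof.
move=> iG; set F := i |: G.
pose c j := (j == p) && (i == q) || (j == q) && (i == p).
have -> : koszul_sign k before (tperm p q i) (swap_face F) =
    koszul_sign k before i F * \prod_(j in F) (-1) ^+ c j.
  rewrite /koszul_sign (reindex_inj (@perm_inj _ (tperm p q))) /= -big_split /=.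
  apply: eq_big => [j|j _]; first by rewrite inE tpermK.
  by rewrite before_tperm signr_addb.
rewrite mulrCA; congr (_ * _).
have -> : \prod_(j in F) (-1) ^+ c j =
    (-1) ^+ ((i == q) && (p \in F) || (i == p) && (q \in F)) :> k.
  have big_pt x : \prod_(j in F) (-1) ^+ (j == x) = (-1) ^+ (x \in F) :> k.
    case: (boolP (x \in F)) => xF.
      by rewrite (bigD1 x) //= eqxx big1 ?mulr1 // => j /andP[_ /negPf ->].
    by apply: big1 => j jF; case: eqP => // jx; rewrite -jx jF in xF.
  rewrite /c; have [->|ip] := eqVneq i p.
    rewrite (negPf neq_pq) /= -big_pt; apply: eq_bigr => j _.
    by rewrite andbF andbT.
  have [_|iq] := eqVneq i q.
    by rewrite /= orbF -big_pt; apply: eq_bigr => j _; rewrite andbT andbF orbF.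
  by apply: big1 => j _; rewrite !andbF.
rewrite /swap_sign -signr_addb; congr (_ ^+ nat_of_bool _).
rewrite /F !inE [p == i]eq_sym [q == i]eq_sym.
have : ~~ ((i == p) && (i == q)) by case: eqP => // ->.
have : (i == p) ==> (p \notin G) by apply/implyP => /eqP <-.
have : (i == q) ==> (q \notin G) by apply/implyP => /eqP <-.
by case: (i == p); case: (i == q); case: (p \in G); case: (q \in G).
Qed.

Definition swap_fun f F : k := swap_sign F * f (swap_face F).

Lemma simplex_diff_swap f G :
  simplex_diff before (swap_fun f) G = swap_fun (simplex_diff before f) G.
Proof.
rewrite /swap_fun /simplex_diff mulr_sumr.
rewrite [RHS](reindex_inj (@perm_inj _ (tperm p q))) /=.
apply: eq_big => [i|i iG]; first by rewrite inE tpermK.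
by rewrite -swap_faceU1 !mulrA koszul_sign_swap.
Qed.

(* The projection onto the faces without p in the multidegrees fixed by the swap:
   it kills the faces through p and sends q |: G to itself, p |: G to q |: G. *)
Definition fold_fun f F : k :=
  if p \in F then 0 else f F + (if q \in F then swap_fun f F else 0).

Lemma simplex_diff_fold f G :
  simplex_diff before (fold_fun f) G = fold_fun (simplex_diff before f) G.
Proof.
rewrite [RHS]/fold_fun; case: ifPn => pG.
  by apply: big1 => i iG; rewrite /fold_fun !inE pG orbT mulr0.
case: ifPn => qG.
  rewrite -simplex_diff_swap /simplex_diff -big_split; apply: eq_bigr => i iG /=.
  rewrite -mulrDr /fold_fun !inE qG orbT (negPf pG) orbF.
  (* The face [p |: G] contains both vertices: the fold vanishes there, and the swap acts by -1, so
     the other side cancels too. *)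
  have [<-|//] := eqVneq p i.
  have pq : (p \in p |: G) = (q \in p |: G) by rewrite !inE eqxx qG orbT.
  by rewrite /swap_fun swap_face_id // /swap_sign -pq setU11 mulN1r subrr.
(* With neither vertex in [G], the fold at [q |: G] collects the contributions of both [q |: G] and
   [p |: G] to the boundary. *)
rewrite addr0 /simplex_diff (bigD1 q) //= [X in _ + X](bigD1 p) ?pG ?neq_pq //=.
rewrite [RHS](bigD1 q) //= [X in _ = _ + X](bigD1 p) ?pG ?neq_pq //=.
rewrite /fold_fun !inE !eqxx /= (negPf neq_pq) (negPf pG) /= mulr0 add0r mulrDr -addrA.
congr (_ + (_ + _)).
  rewrite /swap_fun swap_faceU1 tpermR swap_face_id ?(negPf pG) ?(negPf qG) //.
  rewrite /swap_sign !inE (negPf pG) (negPf neq_pq) /= mul1r; congr (_ * _).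
  have := koszul_sign_swap pG; rewrite swap_faceU1 tpermL swap_face_id ?(negPf pG) ?(negPf qG) //.
  rewrite /swap_sign !inE (negPf pG) (negPf qG) [q == p]eq_sym.
  by rewrite (negPf neq_pq) eqxx /= mul1r mulr1.
apply: eq_bigr => i /andP[/andP[iG iq] ip].
by rewrite !inE ![_ == i]eq_sym (negPf ip) (negPf iq) (negPf pG) (negPf qG) addr0.
Qed.

End SwapFaces.

(** * The fold on bounded chains and its effect on the ideal and its shift *)

Section ShiftedChains.
Variables (k : fieldType) (n : nat) (p q : 'I_n) (t N : nat).
Hypothesis neq_pq : p != q.
Notation T := (chain_index n N).
Notation V := {ffun T -> k^o}.
Notation swap_face := (swap_face p q).
Notation swap_sign := (swap_sign k p q).
Implicit Types (m : 'X_{1..n}) (u : T) (x : V).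

(* x_p^a x_q^b |-> x_p^(b - t) x_q^(a + t); only meaningful when t <= b. *)
Definition swap_mon m : 'X_{1..n} :=
  [multinom if i == p then (m q - t)%N else if i == q then (m p + t)%N else m i | i < n].

Lemma swap_mon_p m : swap_mon m p = (m q - t)%N.
Proof. by rewrite mnmE eqxx. Qed.

Lemma swap_mon_q m : swap_mon m q = (m p + t)%N.
Proof. by rewrite mnmE eq_sym (negPf neq_pq) eqxx. Qed.

Lemma swap_mon_other m i : i != p -> i != q -> swap_mon m i = m i.
Proof. by move=> /negPf ip /negPf iq; rewrite mnmE ip iq. Qed.

Lemma mnm_eq_pq m m' : m p = m' p -> m q = m' q ->
  (forall i, i != p -> i != q -> m i = m' i) -> m = m'.
Proof.
move=> hp hq h; apply/mnmP => i.
by have [->|ip] := eqVneq i p => //; have [->|iq] := eqVneq i q => //; apply: h.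
Qed.

Lemma swap_monK m : (t <= m q)%N -> swap_mon (swap_mon m) = m.
Proof.
move=> le; apply: mnm_eq_pq => [||i ip iq].
- by rewrite swap_mon_p swap_mon_q addnK.
- by rewrite swap_mon_q swap_mon_p subnK.
by rewrite !swap_mon_other.
Qed.

Lemma swap_mon_id m : (m p + t = m q)%N -> swap_mon m = m.
Proof.
move=> e; apply: mnm_eq_pq => [||i ip iq].
- by rewrite swap_mon_p -e addnK.
- by rewrite swap_mon_q.
by rewrite swap_mon_other.
Qed.

Lemma mdeg_swap_mon m : (t <= m q)%N -> mdeg (swap_mon m) = mdeg m.
Proof.
move=> le; rewrite !mdegE (bigD1 p) //= (bigD1 q) 1?eq_sym //=.
rewrite [RHS](bigD1 p) //= [X in _ = (_ + X)%N](bigD1 q) 1?eq_sym //=.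
rewrite swap_mon_p swap_mon_q (eq_bigr m); first by lia.
by move=> i /andP[ip iq]; rewrite swap_mon_other.
Qed.

(** The default of [insubd] is harmless when [t <= u.1 q], since the swap then preserves the degree
    and hence the bound. *)
Definition swap_chain u : T := (insubd u.1 (swap_mon u.1), swap_face u.2).

Lemma swap_chain1 u : (t <= u.1 q)%N -> (swap_chain u).1 = swap_mon u.1 :> 'X_{1..n}.
Proof. by move=> le; rewrite val_insubd mdeg_swap_mon // bmdeg. Qed.

Lemma swap_chain_q u : (t <= u.1 q)%N -> (t <= (swap_chain u).1 q)%N.
Proof. by move=> le; rewrite swap_chain1 // swap_mon_q leq_addl. Qed.

Lemma swap_chainK u : (t <= u.1 q)%N -> swap_chain (swap_chain u) = u.
Proof.
move=> le; have le' := swap_chain_q le.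
have e1 : (swap_chain (swap_chain u)).1 = u.1.
  apply: val_inj; apply: etrans (swap_chain1 le') _.
  by rewrite swap_chain1 // swap_monK.
by rewrite [LHS]surjective_pairing e1 /= swap_faceK -surjective_pairing.
Qed.

(* The smaller half of the bases swapped by x_p^a x_q^b |-> x_p^(b - t) x_q^(a + t),
   according to the total multidegree; in the multidegrees fixed by the swap these
   are the faces through p. *)
Definition lower u :=
  (u.1 p + t < u.1 q)%N || ((u.1 p + t == u.1 q)%N && (p \in u.2)).

Lemma lower_le u : lower u -> (t <= u.1 q)%N.
Proof. by rewrite /lower; move: (u.1 p) (u.1 q) => a b; lia. Qed.

Definition folded u := (t <= u.1 q)%N && lower (swap_chain u).

Lemma lower_swap u : (t <= u.1 q)%N ->
  lower (swap_chain u) = (u.1 q < u.1 p + t)%N || ((u.1 q == u.1 p + t)%N && (q \in u.2)).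
Proof.
move=> le; rewrite /lower swap_chain1 // swap_mon_p swap_mon_q subnK //.
by rewrite in_swap_face tpermL.
Qed.

(** The halves overlap only in multidegrees fixed by the swap, on faces through both [p] and [q]. *)
Lemma lower_fixed u : lower u -> lower (swap_chain u) -> swap_chain u = u.
Proof.
move=> low; have le := lower_le low; rewrite lower_swap // => low'.
have [e pF qF] : [/\ u.1 p + t = u.1 q, p \in u.2 & q \in u.2]%N.
  move: low low'; rewrite /lower; move: (u.1 p) (u.1 q) => a b.
  by case: (p \in u.2); case: (q \in u.2) => *; split=> //; lia.
rewrite [RHS]surjective_pairing; congr (_, _); last by rewrite swap_face_id ?pF ?qF.
by apply: val_inj; apply: etrans (swap_chain1 le) _; rewrite swap_mon_id.
Qed.

(** The map pi of the overview in coordinates: a lower coordinate is erased and its signed value is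
    added at the mirror image. *)
Definition fold_chain_fun x : V :=
  [ffun u => if lower u then 0
   else x u + (if folded u then swap_sign u.2 *: x (swap_chain u) else 0)].

Fact fold_chain_is_linear : linear fold_chain_fun.
Proof.
move=> c x y; apply/ffunP => u; rewrite !ffunE.
case: ifP => _; first by rewrite scaler0 addr0.
case: ifP => _; last by rewrite !addr0.
by rewrite !scalerDr addrACA !scalerA [c * _]mulrC.
Qed.

HB.instance Definition _ :=
  GRing.isLinear.Build k V V _ fold_chain_fun fold_chain_is_linear.

Definition fold_chain : 'End(V) := linfun fold_chain_fun.

Notation chain_diff := (chain_diff k (before p q) N).

Lemma chain_diffE x u : chain_diff x u =
  simplex_diff (before p q) (fun F => x (u.1, F)) u.2.
Proof. by rewrite lfunE /= ffunE. Qed.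

Lemma fold_chainE x u : fold_chain x u = if lower u then 0
   else x u + (if folded u then swap_sign u.2 * x (swap_chain u) else 0).
Proof. by rewrite lfunE /= ffunE. Qed.

Lemma simplex_diffD (f g : {set 'I_n} -> k) G :
  simplex_diff (before p q) (fun F => f F + g F) G =
  simplex_diff (before p q) f G + simplex_diff (before p q) g G.
Proof. by rewrite -big_split; apply: eq_bigr => i _; rewrite mulrDr. Qed.

Lemma fold_chain_diff x : fold_chain (chain_diff x) = chain_diff (fold_chain x).
Proof.
apply/ffunP => -[al G]; rewrite fold_chainE [RHS]chain_diffE /=.
pose f F := x (al, F).
(* Strictly below the diagonal both sides vanish; strictly above, the swap of faces commutes with
   the boundary or there is no mirror image; on the diagonal the fold of faces applies. *)
have [lt|gt|eq] := ltngtP (al p + t)%N (al q).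
- rewrite /lower lt /= [RHS]big1 // => i _.
  by rewrite fold_chainE /lower lt mulr0.
- have up F : lower (al, F) = false by rewrite /lower /= ltnNge (ltnW gt) gtn_eqF.
  rewrite up; have [le|lt] := leqP t (al q); last first.
    rewrite /folded /= leqNgt lt addr0 chain_diffE; apply: simplex_diff_ext => F.
    by rewrite fold_chainE up /folded /= leqNgt lt addr0.
  have fol F : folded (al, F) by rewrite /folded lower_swap /= ?le ?gt.
  rewrite fol !chain_diffE /= -[_ * _]/(swap_fun p q (simplex_diff _ _) G).
  rewrite -simplex_diff_swap // -simplex_diffD; apply: simplex_diff_ext => F.
  by rewrite fold_chainE up fol.
have le : (t <= al q)%N by rewrite -eq leq_addl.
have sw F : swap_chain (al, F) = (al, swap_face F).
  congr (_, _); apply: val_inj; apply: etrans (swap_chain1 (u := (al, F)) le) _.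
  by rewrite swap_mon_id.
have fold_f (y : V) F : (if lower (al, F) then 0 else y (al, F) +
    (if folded (al, F) then swap_sign F * y (swap_chain (al, F)) else 0)) =
    fold_fun p q (fun F => y (al, F)) F.
  rewrite /folded lower_swap //= le /lower /= eq ltnn eqxx /= /fold_fun.
  by rewrite /swap_fun sw.
rewrite fold_f.
rewrite [LHS](_ : _ = fold_fun p q (simplex_diff (before p q) f) G).
  rewrite -simplex_diff_fold //; apply: simplex_diff_ext => F.
  by rewrite fold_chainE fold_f.
by rewrite /fold_fun /swap_fun !chain_diffE.
Qed.

Lemma fold_chain_id x : (forall u, lower u -> x u = 0) -> fold_chain x = x.
Proof.
move=> x0; apply/ffunP => u; rewrite fold_chainE.
case: ifP => [/x0 //|_]; case: ifP => [/andP[_ /x0 ->]|_]; last by rewrite addr0.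
by rewrite mulr0 addr0.
Qed.

Variables (A B : pred 'X_{1..n}).
(** The shift on exponents: a union in the upper half, an intersection in the lower one. On the
    diagonal the swap fixes [m], so the union is just [A m]. *)
Hypothesis BE : forall m, B m =
  if (m q < t)%N then A m
  else if (m q <= m p + t)%N then A m || A (swap_mon m)
  else A m && A (swap_mon m).
Variables (i : nat) (j : int).
Notation wA := (chain_weight A i j).
Notation wB := (chain_weight B i j).

(** Isolates the conditions at [p] and [q], the only ones that the swap alters. *)
Lemma mesym1_leE (F : {set 'I_n}) m : (mesym1 F <= m)%MM =
  [&& (p \in F <= m p)%N, (q \in F <= m q)%N &
      [forall l, [&& l != p, l != q & l \in F] ==> (0 < m l)%N]].
Proof.
apply/mnm_lepP/and3P => [h|[hp hq /forallP h] l].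
  split; first by have := h p; rewrite mnmE.
    by have := h q; rewrite mnmE.
  by apply/forallP => l; apply/implyP => /and3P[_ _ lF]; have := h l; rewrite mnmE lF.
rewrite mnmE; have [->//|lp] := eqVneq l p; have [->//|lq] := eqVneq l q.
by move: (h l); rewrite lp lq; case: (l \in F).
Qed.

Lemma chain_weightE D u : chain_weight D i j u =
  [&& (p \in u.2 <= u.1 p)%N, (q \in u.2 <= u.1 q)%N, D (u.1 - mesym1 u.2)%MM &
  [&& [forall l, [&& l != p, l != q & l \in u.2] ==> (0 < u.1 l)%N],
      #|u.2| == i & (mdeg u.1)%:Z == j]].
Proof.
rewrite /chain_weight mesym1_leE -!andbA; do 2!congr (_ && _).
by rewrite andbCA.
Qed.

Lemma chain_weight_swapE u : (t <= u.1 q)%N -> wA (swap_chain u) =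
  [&& (q \in u.2 <= u.1 q - t)%N, (p \in u.2 <= u.1 p + t)%N,
      A ((swap_chain u).1 - mesym1 (swap_face u.2))%MM &
  [&& [forall l, [&& l != p, l != q & l \in u.2] ==> (0 < u.1 l)%N],
      #|u.2| == i & (mdeg u.1)%:Z == j]].
Proof.
move=> le; rewrite chain_weightE /= -/(swap_chain u) swap_chain1 //.
rewrite !in_swap_face tpermL tpermR swap_mon_p swap_mon_q card_swap_face.
rewrite mdeg_swap_mon //; do 4!congr (_ && _).
apply: eq_forallb => l; case: (eqVneq l p) => //= lp; case: (eqVneq l q) => //= lq.
by rewrite swap_mon_other // in_swap_face tpermD // eq_sym.
Qed.

Lemma swap_chain_mon u : (t <= u.1 q)%N -> (p \in u.2 <= u.1 p)%N ->
  ((swap_chain u).1 - mesym1 (swap_face u.2))%MM = swap_mon (u.1 - mesym1 u.2)%MM.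
Proof.
move=> le leP; rewrite swap_chain1 //; apply: mnm_eq_pq => [||l lp lq].
- rewrite swap_mon_p !mnmBE swap_mon_p !mnmE in_swap_face tpermL; exact: subnAC.
- rewrite swap_mon_q !mnmBE swap_mon_q !mnmE in_swap_face tpermR addnBAC //.
by rewrite swap_mon_other // !mnmBE swap_mon_other // !mnmE in_swap_face tpermD // eq_sym.
Qed.

Lemma weight_lower u : lower u -> wB u = [&& (t <= u.1 q)%N, wA u & wA (swap_chain u)].
Proof.
move=> low; have le := lower_le low.
rewrite le chain_weight_swapE // !chain_weightE BE /=.
set rest := [&& _, #|u.2| == i & _]; case: rest; rewrite ?andbF // !andbT.
have [leP|] /= := leqP (p \in u.2) (u.1 p); last by [].
have [leQ|] /= := leqP (q \in u.2) (u.1 q); last by [].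
rewrite swap_chain_mon //.
(* Removing the face may bring the monomial onto the diagonal, where [B] is a union; there the swap
   fixes it, and union and intersection agree. *)
have swid : (u.1 p - (p \in u.2) + t = u.1 q - (q \in u.2))%N ->
    A (swap_mon (u.1 - mesym1 u.2)%MM) = A (u.1 - mesym1 u.2)%MM.
  by move=> e; rewrite swap_mon_id // !mnmBE !mnmE.
move: low swid; rewrite /lower !mnmBE !mnmE.
case: (A _); case: (A _); case: (p \in u.2) leP; case: (q \in u.2) leQ => /= *;
  do 2?[case: ifP => ?]; lia.
Qed.

Lemma weight_upper u : ~~ lower u ->
  wB u = wA u || (folded u && wA (swap_chain u)).
Proof.
move=> up; rewrite /folded; have [le|lt] := leqP t (u.1 q); last first.
  rewrite /= orbF !chain_weightE BE mnmBE.
  by rewrite (leq_ltn_trans (leq_subr _ _) lt).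
rewrite lower_swap // chain_weight_swapE // !chain_weightE BE /=.
set rest := [&& _, #|u.2| == i & _]; case: rest; rewrite ?andbF // !andbT.
(* When [p] is in the face but has exponent 0, the mirror image must be excluded too: [folded]
   forces [u.1 q = t] and [q] in the face, while the mirrored exponent of [p] is then 0. *)
have [leP|ltP] /= := leqP (p \in u.2) (u.1 p); last first.
  case: (A (_ - mesym1 (swap_face u.2))%MM); rewrite ?andbF //.
  move: le up ltP; rewrite /lower; move: (u.1 p) (u.1 q) => a b.
  by case: (p \in u.2); case: (q \in u.2) => /= *; lia.
rewrite swap_chain_mon //.
have swid : (u.1 p - (p \in u.2) + t = u.1 q - (q \in u.2))%N ->
    A (swap_mon (u.1 - mesym1 u.2)%MM) = A (u.1 - mesym1 u.2)%MM.
  by move=> e; rewrite swap_mon_id // !mnmBE !mnmE.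
move: le up leP swid; rewrite /lower !mnmBE !mnmE; move: (u.1 p) (u.1 q) => a b.
case: (A _); case: (A _); case: (p \in u.2); case: (q \in u.2) => /= *;
  do 2?[case: ifP => ?]; lia.
Qed.

Notation WA := (chain_space k N A i j).
Notation WB := (chain_space k N B i j).

Lemma fold_chain_sub x : x \in WA -> fold_chain x \in WB.
Proof.
move=> /coord_spaceP xA; apply/coord_spaceP => u; rewrite fold_chainE.
case: ifPn => [_|up]; first by rewrite eqxx.
rewrite weight_upper //; have [x0|/xA ->//] := eqVneq (x u) 0.
rewrite x0 add0r; case: ifP => [fu|_]; last by rewrite eqxx.
by rewrite mulf_eq0 negb_or => /andP[_ /xA ->]; rewrite orbT.
Qed.

Lemma fold_chain_lower x u : lower u -> fold_chain x u = 0.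
Proof. by rewrite fold_chainE => ->. Qed.

(** The fold is idempotent and sends [WA] into [WB]. *)
Lemma fold_chain_space_le : (fold_chain @: WA <= fold_chain @: WB)%VS.
Proof.
apply/subvP => _ /memv_imgP[x xA ->]; apply/memv_imgP.
exists (fold_chain x); first exact: fold_chain_sub.
by rewrite (@fold_chain_id (fold_chain x)) // => u; apply: fold_chain_lower.
Qed.

(** The difference only involves values of [x] at lower elements, and a lower element of [WB] has
    both itself and its mirror image in [WA]. *)
Lemma sub_fold_chain x : x \in WB -> x - fold_chain x \in WA.
Proof.
move=> /coord_spaceP xB; apply/coord_spaceP => u; rewrite !ffunE fold_chainE.
case: ifPn => [low|up].
  by rewrite subr0 => /xB; rewrite weight_lower // => /and3P[].
rewrite opprD addrA subrr add0r oppr_eq0.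
case: ifP => [/andP[le low]|_]; last by rewrite eqxx.
rewrite mulf_eq0 negb_or => /andP[_ /xB]; rewrite weight_lower // => /and3P[_ _].
by rewrite swap_chainK.
Qed.

(** Where the fold vanishes, a nonzero lower coordinate is cancelled by a nonzero one at its mirror
    image, unless it is its own mirror. Either way both indices belong to [WA], as [weight_lower]
    requires. *)
Lemma ker_fold_chain x : x \in WA -> fold_chain x = 0 -> x \in WB.
Proof.
move=> /coord_spaceP xA /ffunP x0; apply/coord_spaceP => u nz.
have [low|up] := boolP (lower u); last by rewrite weight_upper // xA.
have le := lower_le low; rewrite weight_lower // le xA //=.
have [low'|up'] := boolP (lower (swap_chain u)); first by rewrite lower_fixed // xA.
apply: xA; have := x0 (swap_chain u); rewrite fold_chainE (negPf up') ffunE.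
rewrite /folded swap_chain_q // swap_chainK // low /=.
have [->|//] := eqVneq (x (swap_chain u)) 0.
rewrite add0r => /eqP; rewrite mulf_eq0 (negPf nz) orbF => /eqP s0.
by have /eqP := swap_sign_sqr k p q (swap_face u.2); rewrite s0 mul0r eq_sym oner_eq0.
Qed.

Lemma fold_chain_space_ge : (fold_chain @: WB <= fold_chain @: WA)%VS.
Proof.
apply/subvP => _ /memv_imgP[x /coord_spaceP xB ->]; apply/memv_imgP.
set y := fold_chain x.
have yB u : ~~ wB u -> y u = 0.
  move=> nB; rewrite /y fold_chainE; case: ifPn => // up.
  have [->|/xB wu] := eqVneq (x u) 0; last by rewrite wu in nB.
  rewrite add0r; case: ifP => // /andP[le low].
  have [->|/xB] := eqVneq (x (swap_chain u)) 0; first by rewrite mulr0.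
  rewrite weight_lower // swap_chainK // => /and3P[_ _ wu].
  by rewrite weight_upper // wu in nB.
(* A preimage in [WA] of the folded vector [y]: coordinates allowed by [A] stay, the others move
   with their sign to the lower mirror image, which [weight_upper] places in [WA]. *)
pose z : V := [ffun u => if ~~ wA u then 0 else if ~~ lower u then y u
  else if wA (swap_chain u) then 0 else swap_sign u.2 * y (swap_chain u)].
exists z.
  by apply/coord_spaceP => u; rewrite ffunE; case: (wA u); rewrite ?eqxx.
apply/ffunP => u; rewrite [RHS]fold_chainE; case: ifPn => [low|up].
  exact: fold_chain_lower.
have := weight_upper up; rewrite {1}/z !ffunE up.
have [fu|_] := boolP (folded u); last first.
  by rewrite orbF addr0; case: (wA u) => //= wB0; rewrite yB ?wB0.
have /andP[le low] := fu; rewrite swap_chainK // low /=.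
case: (wA u) => /=; first by case: (wA _); rewrite /= mulr0 addr0.
case: (wA (swap_chain u)) => /= wBu; last by rewrite yB ?wBu // mulr0 addr0.
by rewrite add0r mulrA swap_sign_swap swap_sign_sqr mul1r.
Qed.

End ShiftedChains.

(** * Comparison of Koszul homology dimensions *)

Section KoszulDimShift.
Variables (k : fieldType) (n : nat) (p q : 'I_n) (t N : nat).
Hypothesis neq_pq : p != q.
Variables (A B : pred 'X_{1..n}).
Hypothesis BE : forall m, B m =
  if (m q < t)%N then A m
  else if (m q <= m p + t)%N then A m || A (swap_mon p q t m)
  else A m && A (swap_mon p q t m).

Lemma koszul_dim_shift i j :
  (koszul_dim k (before p q) N A i j <= koszul_dim k (before p q) N B i j)%N.
Proof.
have rank_le i' : (\dim (chain_diff k (before p q) N @: chain_space k N B i' j) <=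
    \dim (chain_diff k (before p q) N @: chain_space k N A i' j))%N.
  apply: (@rank_le_of_projection _ _ _ (fold_chain k p q t N)).
  - exact: fold_chain_diff.
  - exact: fold_chain_space_ge.
  exact: sub_fold_chain.
have dim_le : (\dim (chain_space k N A i j) <= \dim (chain_space k N B i j))%N.
  apply: (@dim_le_of_projection _ _ (fold_chain k p q t N)).
    exact: fold_chain_space_le.
  exact: ker_fold_chain.
(* Cycles number the dimension of the chains minus the rank. Passing to [B] raises the dimension and
   lowers both ranks, so cycles grow and boundaries shrink. *)
apply: leq_sub (rank_le i.+1); move: dim_le (rank_le i).
rewrite -(limg_ker_dim (chain_diff k (before p q) N) (chain_space k N A i j)).
rewrite -(limg_ker_dim (chain_diff k (before p q) N) (chain_space k N B i j)).
move=> dim_le' rank_i.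
rewrite -(leq_add2r (\dim (chain_diff k (before p q) N @: chain_space k N A i j))).
by apply: leq_trans dim_le' _; rewrite leq_add2l.
Qed.

End KoszulDimShift.

(** * Monomial ideals and their shifts *)

Section MonomialSpans.
Variables (k : fieldType) (n : nat).
Notation S := {mpoly k[n]}.
Implicit Types (I : S -> Prop).

Lemma monomial_spanP (A : 'X_{1..n} -> Prop) (f : S) :
  monomial_span A f <-> forall m, f@_m != 0 -> A m.
Proof.
split=> [[s [hs ->]] m|hf].
  rewrite (raddf_sum (mcoeff m)) /= => nz.
  have [u us] : exists2 u, u \in s & (u.1 *: 'X_[u.2])@_m != 0.
    apply/hasP; apply: contraNT nz => /hasPn h; rewrite big_seq big1 // => u us.
    by apply/eqP/negPn/h.
  rewrite mcoeffZ mcoeffX; have [<- _|_] := eqVneq u.2 m; first exact: hs.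
  by rewrite mulr0 eqxx.
exists [seq (f@_m, m) | m <- msupp f]; split.
  by move=> _ /mapP[m hm ->] /=; apply: hf; rewrite -mcoeff_msupp.
by rewrite big_map [LHS]mpolyE.
Qed.

Lemma monomial_ideal_up I : monomial_ideal I ->
  (forall f, I f <-> forall m, f@_m != 0 -> I 'X_[m]) /\
  (forall m m', I 'X_[m] -> I 'X_[m + m']).
Proof.
case=> A IA.
have gen m a : A a -> I 'X_[a + m].
  move=> ha; apply/IA; exists [:: ('X_[m], 'X_[a])]; split.
    by move=> u; rewrite inE => /eqP -> /=; exists a.
  by rewrite big_seq1 /= mpolyXD mulrC.
have sup f m : I f -> f@_m != 0 -> exists2 a, A a & (a <= m)%MM.
  case/IA => s [hs ->]; rewrite (raddf_sum (mcoeff m)) /= => nz.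
  have [u us nzu] : exists2 u, u \in s & (u.1 * u.2)@_m != 0.
    apply/hasP; apply: contraNT nz => /hasPn h; rewrite big_seq big1 // => u us.
    by apply/eqP/negPn/h.
  have [a ha uE] := hs u us; exists a => //.
  by move: nzu; rewrite uE mcoeffMX_if; case: ifP => //; rewrite eqxx.
have mon m : I 'X_[m] <-> exists2 a, A a & (a <= m)%MM.
  split=> [h|[a ha /submK <-]]; last by rewrite addmC; apply: gen.
  by apply: sup h _; rewrite mcoeffX eqxx oner_eq0.
split=> [f|m m' /mon [a ha le]]; last first.
  by apply/mon; exists a => //; apply: lepm_trans le (lem_addr _ _).
split=> [hf m nz|hf]; first by apply/mon; apply: sup hf nz.
apply/IA.
(* Each support monomial gets a generator dividing it; off the support the choice is arbitrary. *)
have /choice [a ha] : forall m, exists a, m \in msupp f -> A a /\ (a <= m)%MM.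
  move=> m; case: (boolP (m \in msupp f)) => [|_]; last by exists m.
  by rewrite mcoeff_msupp => /hf /mon [a ? ?]; exists a.
exists [seq (f@_m *: 'X_[m - a m], 'X_[a m]) | m <- msupp f]; split.
  by move=> _ /mapP[m /ha [hm _] ->] /=; exists (a m).
rewrite big_map {1}[f]mpolyE; apply: eq_big_seq => m /ha [_ le] /=.
by rewrite -scalerAl -mpolyXD submK.
Qed.

Variables (p q : 'I_n) (t : nat).
Hypothesis neq_pq : p != q.
Implicit Types m : 'X_{1..n}.

Lemma mon_abE (f : 'X_{1..n}) s l i : mon_ab p q f s l i =
  (f i + (p == i) * s + (q == i) * l)%N.
Proof. by rewrite !mnmDE !mulmnE !mnm1E. Qed.

Lemma not_divisibleE (x : 'I_n) (f : 'X_{1..n}) : not_divisible x f = (f x == 0%N).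
Proof. by rewrite /not_divisible lep1mP negbK. Qed.

Lemma mon_ab_p (f : 'X_{1..n}) s l : not_divisible p f -> mon_ab p q f s l p = s.
Proof.
rewrite not_divisibleE mon_abE => /eqP ->.
by rewrite eqxx eq_sym (negPf neq_pq) addn0 mul1n.
Qed.

Lemma mon_ab_q (f : 'X_{1..n}) s l : not_divisible q f -> mon_ab p q f s l q = l.
Proof.
rewrite not_divisibleE mon_abE => /eqP ->.
by rewrite eqxx (negPf neq_pq) mul1n.
Qed.

Lemma mon_ab_other (f : 'X_{1..n}) s l i : i != p -> i != q -> mon_ab p q f s l i = f i.
Proof.
by rewrite mon_abE ![i == _]eq_sym => /negPf -> /negPf ->; rewrite !addn0.
Qed.

Lemma mon_abP m : exists f, [/\ not_divisible p f, not_divisible q f &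
  m = mon_ab p q f (m p) (m q)].
Proof.
exists [multinom if (i == p) || (i == q) then 0 else m i | i < n]%N.
set f := [multinom _ | _ < n].
have fp : not_divisible p f by rewrite not_divisibleE mnmE eqxx.
have fq : not_divisible q f by rewrite not_divisibleE mnmE eqxx orbT.
split=> //; apply: (mnm_eq_pq (p := p) (q := q)) => [||i ip iq].
- by rewrite mon_ab_p.
- by rewrite mon_ab_q.
by rewrite mon_ab_other // mnmE (negPf ip) (negPf iq).
Qed.

Lemma swap_mon_ab f s l : not_divisible p f -> not_divisible q f ->
  swap_mon p q t (mon_ab p q f s (l + t)) = mon_ab p q f l (s + t).
Proof.
move=> fp fq; apply: (mnm_eq_pq (p := p) (q := q)) => [||i ip iq].
- by rewrite swap_mon_p mon_ab_q // mon_ab_p // addnK.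
- by rewrite swap_mon_q // mon_ab_q // mon_ab_p.
by rewrite swap_mon_other // !mon_ab_other.
Qed.

(** The four clauses correspond to comparing [m q] with [t] and then with [m p + t]; the diagonal
    clause is absorbed by the union. *)
Lemma shift_monomialE I m : shift_monomial p q t I m <->
  if (m q < t)%N then I 'X_[m]
  else if (m q <= m p + t)%N then I 'X_[m] \/ I 'X_[swap_mon p q t m]
  else I 'X_[m] /\ I 'X_[swap_mon p q t m].
Proof.
split.
  case=> {m} [f s l fp fq lt h|f s fp fq h|f s l fp fq lt h|f s l fp fq lt h1 h2];
    rewrite ?mon_ab_p ?mon_ab_q //.
  - by rewrite lt.
  - by rewrite ltnNge leq_addl leqnn /=; left.
  - rewrite ltnNge leq_addl leq_add2r (ltnW lt) /= swap_mon_ab //.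
  - by rewrite ltnNge leq_addl leq_add2r leqNgt lt /= swap_mon_ab.
have [f [fp fq ->]] := mon_abP m; move: (m p) (m q) => s l.
rewrite mon_ab_p // mon_ab_q //; have [lt h|le] := ltnP l t; first exact: ShiftLow.
rewrite -(subnK le) leq_add2r swap_mon_ab //; move: (l - t)%N => {le}l.
have [lt h|lt [h1 h2]|<- h] := ltngtP l s.
- exact: ShiftUpper.
- exact: ShiftLower.
by apply: ShiftDiag => //; case: h.
Qed.

Lemma shift_monomial_up I m m' :
  (forall a b, I 'X_[a] -> I 'X_[a + b]) ->
  shift_monomial p q t I m -> shift_monomial p q t I (m + m')%MM.
Proof.
move=> I_up.
have I_le a b : (a <= b)%MM -> I 'X_[a] -> I 'X_[b].
  by move=> /submK <- h; rewrite addmC; apply: I_up.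
rewrite !shift_monomialE !mnmDE.
have le_pq (a b : 'X_{1..n}) : (a p <= b p)%N -> (a q <= b q)%N ->
    (forall i, i != p -> i != q -> a i <= b i)%N -> (a <= b)%MM.
  move=> hp hq h; apply/mnm_lepP => i.
  by have [->//|ip] := eqVneq i p; have [->//|iq] := eqVneq i q; apply: h.
set m1 := (m + m')%MM; set sm := swap_mon p q t m; set sm1 := swap_mon p q t m1.
have m1p : m1 p = (m p + m' p)%N by rewrite mnmDE.
have m1q : m1 q = (m q + m' q)%N by rewrite mnmDE.
have smp : sm p = (m q - t)%N by rewrite /sm swap_mon_p.
have smq : sm q = (m p + t)%N by rewrite /sm swap_mon_q.
have sm1p : sm1 p = (m1 q - t)%N by rewrite /sm1 swap_mon_p.
have sm1q : sm1 q = (m1 p + t)%N by rewrite /sm1 swap_mon_q.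
have oth i : i != p -> i != q -> [/\ m1 i = (m i + m' i)%N, sm i = m i & sm1 i = m1 i].
  by move=> ip iq; rewrite /sm1 /sm /m1 mnmDE !swap_mon_other // mnmDE.
have Im : I 'X_[m] -> I 'X_[m1] by apply: I_up.
have Is : I 'X_[sm] -> I 'X_[sm1].
  by apply: I_le; apply: le_pq => [||i ip iq];
    last case: (oth i ip iq); lia.
(* Multiplication may cross the diagonal from the upper to the lower half. Then [m] divides [sm1]
   and [sm] divides [m1], so either monomial of the union yields both of the intersection. *)
have Ims : (m q <= m p + t)%N -> (m1 p + t < m1 q)%N -> I 'X_[m] -> I 'X_[sm1].
  by move=> *; apply: I_le (m) _ _ _ => //; apply: le_pq => [||i ip iq];
    last case: (oth i ip iq); lia.
have Ism : (m q <= m p + t)%N -> (m1 p + t < m1 q)%N -> I 'X_[sm] -> I 'X_[m1].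
  by move=> *; apply: I_le (sm) _ _ _ => //; apply: le_pq => [||i ip iq];
    last case: (oth i ip iq); lia.
rewrite -m1p -m1q.
have [lt1|le1] := ltnP (m1 q) t.
  have -> : (m q < t)%N by lia.
  exact: Im.
have [le2|lt2] := leqP (m1 q) (m1 p + t).
  case: ltnP => _; first by left; apply: Im.
  case: leqP => _; last by case=> h _; left; apply: Im.
  by case=> [/Im|/Is]; [left | right].
case: ltnP => [lt|_].
  by move=> h; split; [apply: Im | apply: Ims => //; lia].
case: leqP => [le|_]; last by case=> /Im ? /Is.
case=> h; split; [exact: Im|exact: Ims|exact: Ism|exact: Is].
Qed.

End MonomialSpans.

(** Ideals are [Prop]-valued while coordinate subspaces need boolean predicates; excluded middle
    bridges them. *)
Definition prop_pred (T : Type) (P : T -> Prop) : pred T :=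
  fun x => if excluded_middle_informative (P x) then true else false.

Lemma prop_predP (T : Type) (P : T -> Prop) x : reflect (P x) (prop_pred P x).
Proof. by rewrite /prop_pred; case: excluded_middle_informative => h; constructor. Qed.

Theorem theorem5p5 (k : fieldType) (n : nat) (p q : 'I_n) (hpq : (p < q)%N)
    (I : {mpoly k[n]} -> Prop) (hI : monomial_ideal I) (t : nat)
    (i : nat) (j : int) :
  (betti I i j <= betti (Shift p q t I) i j)%N.
Proof.
have neq_pq : p != q by rewrite neq_ltn hpq.
have [IE I_up] := monomial_ideal_up hI.
pose A : pred 'X_{1..n} := prop_pred (fun m => I 'X_[m]).
pose B : pred 'X_{1..n} := prop_pred (shift_monomial p q t I).
have AP m : reflect (I 'X_[m]) (A m) by apply: prop_predP.
have BP m : reflect (shift_monomial p q t I m) (B m) by apply: prop_predP.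
have IA f : I f <-> forall m, f@_m != 0 -> A m.
  by rewrite IE; split=> h m /h /AP.
have JB f : Shift p q t I f <-> forall m, f@_m != 0 -> B m.
  by rewrite /Shift monomial_spanP; split=> h m /h /BP.
have A_up m m' : A m -> A (m + m')%MM by move=> /AP h; apply/AP/I_up.
have B_up m m' : B m -> B (m + m')%MM.
  by move=> /BP h; apply/BP/shift_monomial_up.
have BE m : B m = if (m q < t)%N then A m
    else if (m q <= m p + t)%N then A m || A (swap_mon p q t m)
    else A m && A (swap_mon p q t m).
  apply/BP/idP; rewrite shift_monomialE //; case: ifP => _; try by move/AP.
    by case: ifP => _; [case=> /AP ->; rewrite ?orbT | case=> /AP -> /AP ->].
  by case: ifP => _; [case/orP => /AP; [left|right] | case/andP => /AP ? /AP].
have r_tour := before_tournament p q.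
(* The same degree bound is used for both ideals, so their chains lie in one space. *)
have lt_jN : (`|j| < `|j|.+1)%N by [].
rewrite (betti_koszul_dim r_tour IA A_up lt_jN).
rewrite (betti_koszul_dim r_tour JB B_up lt_jN).
exact: koszul_dim_shift.
Qed.
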